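(* Let $\phi\colon A\to B$ be a homomorphism of Artin algebras which is radical-preserving and has superfluous kernel. Then $$\mathsf{fin.dim}\,A\;\le\;\mathsf{fin.dim}\,B+\mathsf{pd}\,B_A .$$ Moreover, the analogous inequalities hold for the big finitistic dimension and the global dimension, i.e. $\mathsf{Fin.dim}\,A\le \mathsf{Fin.dim}\,B+\mathsf{pd}\,B_A$ and $\mathsf{gl.dim}\,A\le \mathsf{gl.dim}\,B+\mathsf{pd}\,B_A$.
   Context: Rings are associative with unit, and homomorphisms are unital. $J(R)$ is the Jacobson radical of $R$. A ring homomorphism $\phi\colon A\to B$ is radical-preserving if $\phi(J(A))\subseteq J(B)$; its kernel is called superfluous if $\mathrm{Ker}\,\phi\subseteq J(A)$. $\mathsf{pd}\,B_A$ is the projective dimension of $B$ as a right $A$-module via restriction of scalars along $\phi$ (possibly $\infty$). For a ring $R$: $\mathsf{fin.dim}\,R$ (little finitistic dimension) is the supremum of the projective dimensions of finitely generated left $R$-modules of finite projective dimension; $\mathsf{Fin.dim}\,R$ (big finitistic dimension) is the supremum of the projective dimensions of all left $R$-modules of finite projective dimension; $\mathsf{gl.dim}\,R$ is the (left) global dimension. *)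

(* Defs.v *)
From HB Require Import structures.
From mathcomp Require Import all_boot all_algebra.
From mathcomp Require Import boolp.

Set Implicit Arguments.
Unset Strict Implicit.
Unset Printing Implicit Defensive.

Import GRing.Theory.
Local Open Scope ring_scope.

(* Left R-modules are lmodType R, right R-modules are lmodType R^c.  Ideals are
   boolean predicates and modules carry a choice structure; with the classical
   axioms of boolp neither is a restriction. *)

Variant enat : Type := Fin of nat | Infty.

Definition enat_le (x y : enat) : bool :=
  match x, y with
  | _, Infty => true
  | Infty, Fin _ => false
  | Fin m, Fin n => (m <= n)%N
  end.

Definition enat_add (x y : enat) : enat :=
  match x, y with
  | Fin m, Fin n => Fin (m + n)
  | _, _ => Infty
  end.

Definition enat_least (P : nat -> Prop) : enat :=
  match pselect (exists n, `[< P n >]) with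
  | left exP => Fin (ex_minn exP)
  | right _ => Infty
  end.

Definition enat_sup (S : enat -> Prop) : enat :=
  enat_least (fun n => forall x, S x -> enat_le x (Fin n)).

Lemma enat_least_le (P : nat -> Prop) (n : nat) :
  P n -> enat_le (enat_least P) (Fin n).
Proof.
move=> Pn; rewrite /enat_least; case: pselect => [exP|[]]; last first.
  by exists n; apply/asboolP.
by case: ex_minnP => m _ /(_ n); rewrite /=; apply; apply/asboolP.
Qed.

Lemma enat_leastP (P : nat -> Prop) (n : nat) : enat_least P = Fin n -> P n.
Proof.
rewrite /enat_least; case: pselect => // exP.
by case: ex_minnP => m /asboolP Pm _ [<-].
Qed.

Lemma enat_sup_ub (S : enat -> Prop) (x : enat) : S x -> enat_le x (enat_sup S).
Proof.
move=> Sx; case E: (enat_sup S) => [n|]; last by case: x {Sx}.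
exact: (enat_leastP E).
Qed.

Lemma enat_sup_lub (S : enat -> Prop) (y : enat) :
  (forall x, S x -> enat_le x y) -> enat_le (enat_sup S) y.
Proof.
case: y => [n|_]; last by case: (enat_sup S).
exact: enat_least_le.
Qed.

Definition finitely_generated (R : pzRingType) (M : lmodType R) : Prop :=
  exists (n : nat) (g : 'I_n -> M),
    forall x : M, exists c : 'I_n -> R, x = \sum_(i < n) c i *: g i.

Definition projective (R : pzRingType) (P : lmodType R) : Prop :=
  forall (M N : lmodType R) (g : {linear M -> N}) (f : {linear P -> N}),
    (forall y : N, exists x : M, g x = y) ->
    exists h : {linear P -> M}, forall x : P, g (h x) = f x.

(* 0 -> P n -> ... -> P 1 -> P 0 -> M -> 0, padded by zero modules beyond n. *)
Definition has_projective_resolution_of_length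
    (R : pzRingType) (M : lmodType R) (n : nat) : Prop :=
  exists (P : nat -> lmodType R)
         (d : forall i : nat, {linear P i.+1 -> P i})
         (e : {linear P 0%N -> M}),
    [/\ forall i, projective (P i),
        forall i, (n < i)%N -> forall x : P i, x = 0,
        forall y : M, exists x : P 0%N, e x = y,
        forall x : P 0%N, e x = 0 <-> exists y, d 0%N y = x
      & forall i (x : P i.+1), d i x = 0 <-> exists y, d i.+1 y = x].

(* With this convention the zero module has projective dimension 0, not -oo. *)
Definition pd (R : pzRingType) (M : lmodType R) : enat :=
  enat_least (has_projective_resolution_of_length M).

Definition findim (R : pzRingType) : enat :=
  enat_sup (fun x => exists M : lmodType R,
    [/\ finitely_generated M, pd M <> Infty & x = pd M]).

Definition Findim (R : pzRingType) : enat :=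
  enat_sup (fun x => exists M : lmodType R, pd M <> Infty /\ x = pd M).

Definition gldim (R : pzRingType) : enat :=
  enat_sup (fun x => exists M : lmodType R, x = pd M).

Definition left_ideal (R : pzRingType) (I : {pred R}) : Prop :=
  submod_closed (I : {pred R^o}).

Definition maximal_left_ideal (R : pzRingType) (I : {pred R}) : Prop :=
  [/\ left_ideal I,
      exists x, x \notin I
    & forall K : {pred R}, left_ideal K -> {subset I <= K} ->
        (exists x, x \notin K) -> {subset K <= I}].

Definition jacobson_radical (R : pzRingType) (x : R) : Prop :=
  forall I : {pred R}, maximal_left_ideal I -> x \in I.

Definition artinian (k : comPzRingType) : Prop :=
  forall I : nat -> {pred k},
    (forall n, left_ideal (I n)) ->
    (forall n, {subset I n.+1 <= I n}) ->
    exists N, forall n, (N <= n)%N -> I n =i I N.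

Definition artin_algebra (k : comPzRingType) (A : algType k) : Prop :=
  artinian k /\ finitely_generated A.

Definition radical_preserving (A B : pzRingType) (phi : {rmorphism A -> B}) :
    Prop :=
  forall x : A, jacobson_radical x -> jacobson_radical (phi x).

Definition superfluous_kernel (A B : pzRingType) (phi : {rmorphism A -> B}) :
    Prop :=
  forall x : A, phi x = 0 -> jacobson_radical x.

Definition restr_right (A B : pzRingType) (phi : {rmorphism A -> B}) : Type := B.

Section RestrictionOfScalars.
Variables (A B : pzRingType) (phi : {rmorphism A -> B}).
Local Notation BA := (restr_right phi).

HB.instance Definition _ := GRing.Zmodule.copy BA B.

Definition restr_right_scale (a : A^c) (b : BA) : BA :=
  (b : B) * phi (a : A).

Fact restr_right_scaleA (a1 a2 : A^c) (b : BA) :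
  restr_right_scale a1 (restr_right_scale a2 b) = restr_right_scale (a1 * a2) b.
Proof. by rewrite /restr_right_scale -mulrA -rmorphM. Qed.

Fact restr_right_scale1 : left_id 1 restr_right_scale.
Proof. by move=> b; rewrite /restr_right_scale rmorph1 mulr1. Qed.

Fact restr_right_scaleDr : right_distributive restr_right_scale +%R.
Proof. by move=> a b c; rewrite /restr_right_scale mulrDl. Qed.

Fact restr_right_scaleDl (b : BA) :
  {morph restr_right_scale^~ b : a1 a2 / a1 + a2}.
Proof. by move=> a1 a2; rewrite /restr_right_scale rmorphD mulrDr. Qed.

HB.instance Definition _ := GRing.Zmodule_isLmodule.Build A^c BA
  restr_right_scaleA restr_right_scale1 restr_right_scaleDr restr_right_scaleDl.
End RestrictionOfScalars.

Definition pd_right (A B : pzRingType) (phi : {rmorphism A -> B}) : enat :=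
  pd (restr_right phi : lmodType A^c).

(* Main.v *)
Require Import Defs.
From HB Require Import structures.
From mathcomp Require Import all_boot all_algebra ring_quotient.
From mathcomp Require Import boolp classical_sets functions.

Set Implicit Arguments.
Unset Strict Implicit.
Unset Printing Implicit Defensive.

Import GRing.Theory.
Local Open Scope ring_scope.

(** Why the theorem holds.

    Let m be the projective dimension of B as a right A-module and let M be a
    left A-module, with a resolution F by free modules A^(X i) and with
    differentials d i.  Applying B (x)_A - gives the complex of free B-modules
    B^(X i), whose homology in degree i is Tor_i^A(B, M); it vanishes for i > m.
    So beyond degree m this complex is a free resolution of the B-module
    N = coker (B (x) d m), that is, of B (x) (the m-th syzygy of M).

    The projective dimension of M is at most n exactly when the n-th syzygy
    coker (d n) is projective, and this can be read off the differential: it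
    means that d n s d n = d n for some linear s ([projdim_le_resolution]).
    Likewise pd N <= q exactly when B (x) d (q + m) satisfies such an equation
    ([projdim_le_coker]).  Base change preserves equations, so finiteness of
    pd M passes to pd N.  The heart of the matter is the converse descent
    ([regular_descent]): if B (x) d0 is regular and the base-changed complex is
    exact at the source of d0, then d0 is regular.  It gives pd M <= pd N + m
    ([pd_comparison]); for finitely generated M all F i can be taken of finite
    rank because A is noetherian, and then N is finitely generated.  The three
    inequalities are suprema of this one.

    Descent.  Write J for the radical of A.  For y in the source of d0 with
    d0 y in J F, radical preservation puts B (x) d0 (1 (x) y) in J(B) B^(X);
    regularity and exactness then place 1 (x) y in the image of the previous
    differential plus J(B) B^(X).  Superfluity of the kernel makes
    A/J -> B/J(B) injective ([jacobson_reflect]), and, A/J being semisimple, it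
    splits as a map of right A-modules ([right_complement]); so the same
    membership holds over A, and d0 y lies in J (im d0) ([image_radical]).  This
    says Tor_1^A(A/J, coker d0) = 0.  Semisimplicity of A/J on the left then
    gives an endomorphism s of F with image in im d0 and equal to the identity
    on im d0 modulo J (im d0).  As J is nilpotent, some power of 1 - s kills
    im d0, and 1 - (1 - s)^t is a retraction of F onto im d0.

    The only tensor products that occur are V (x)_A A^(X) = V^(X), the finitely
    supported functions from X to V. *)

(** * Submodules, quotients and cokernels *)

Section LinearMap.
Variables (R : pzRingType) (U V : lmodType R) (f : U -> V).

Definition linear_fun (f_lin : linear f) : U -> V := f.
HB.instance Definition _ (f_lin : linear f) :=
  GRing.isLinear.Build R U V *:%R (linear_fun f_lin) f_lin.
Definition to_linear (f_lin : linear f) : {linear U -> V} := linear_fun f_lin.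
Lemma to_linearE (f_lin : linear f) x : to_linear f_lin x = f x.
Proof. by []. Qed.
End LinearMap.

Section Submodule.
Variables (R : pzRingType) (V : lmodType R).
Implicit Types S : V -> Prop.

Definition submodule S :=
  S 0 /\ forall (a : R) x y, S x -> S y -> S (a *: x + y).

Lemma submodule0 S : submodule S -> S 0.
Proof. by case. Qed.
Lemma submoduleD S x y : submodule S -> S x -> S y -> S (x + y).
Proof. by case=> _ hS Sx Sy; rewrite -[x]scale1r; apply: hS. Qed.
Lemma submoduleZ S a x : submodule S -> S x -> S (a *: x).
Proof. by case=> S0 hS Sx; rewrite -[_ *: _]addr0; apply: hS. Qed.
Lemma submoduleB S x y : submodule S -> S x -> S y -> S (x - y).
Proof.
by move=> hS Sx Sy; apply: submoduleD => //; rewrite -scaleN1r; apply: submoduleZ.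
Qed.
Lemma submodule_sum S (I : Type) (r : seq I) (F : I -> V) :
  submodule S -> (forall i, S (F i)) -> S (\sum_(i <- r) F i).
Proof.
move=> hS SF; elim: r => [|i r IH]; first by rewrite big_nil; apply: submodule0.
by rewrite big_cons; apply: submoduleD.
Qed.

Lemma submodule_im (U : lmodType R) (f : {linear U -> V}) :
  submodule (fun y => exists x, f x = y).
Proof.
split; first by exists 0; rewrite linear0.
by move=> a _ _ [x <-] [y <-]; exists (a *: x + y); rewrite linearP.
Qed.
End Submodule.

Section Quotient.
Variables (R : pzRingType) (V : lmodType R) (S : V -> Prop).
Hypothesis S_sub : submodule S.

Definition submodule_pred (_ : submodule S) : {pred V} := fun x => `[< S x >].

Fact submodule_predE x : (x \in submodule_pred S_sub) = `[< S x >].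
Proof. by []. Qed.

Fact submodule_pred_closed : zmod_closed (submodule_pred S_sub).
Proof.
split; first by rewrite submodule_predE; apply/asboolP; exact: (submodule0 S_sub).
move=> x y; rewrite !submodule_predE => /asboolP Sx /asboolP Sy.
by apply/asboolP; apply: (submoduleB S_sub).
Qed.
HB.instance Definition _ :=
  GRing.isZmodClosed.Build V (submodule_pred S_sub) submodule_pred_closed.

Definition quotient_module := Quotient.quot (submodule_pred S_sub).
HB.instance Definition _ := GRing.Zmodule.on quotient_module.

Definition coset (x : V) : quotient_module := (\pi_quotient_module x)%qT.

Lemma cosetP x y : coset x = coset y <-> S (x - y).
Proof.
have := Quotient.idealrBE (submodule_pred S_sub) x y.
rewrite submodule_predE /coset => E; split.
  by move/eqP; rewrite -E => /asboolP.
by move=> Sxy; apply/eqP; rewrite -E; apply/asboolP.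
Qed.

Lemma coset_surj (y : quotient_module) : exists x, coset x = y.
Proof. by exists (repr y); rewrite /coset reprK. Qed.

Lemma cosetD x y : coset (x + y) = coset x + coset y.
Proof. by rewrite /coset !piE. Qed.

Definition coset_scale (a : R) (x : quotient_module) : quotient_module :=
  coset (a *: repr x).

Lemma coset_scaleE a x : coset_scale a (coset x) = coset (a *: x).
Proof.
apply/cosetP; rewrite -scalerBr; apply: submoduleZ => //; apply/cosetP.
by rewrite /coset reprK.
Qed.

Fact coset_scaleA a b x : coset_scale a (coset_scale b x) = coset_scale (a * b) x.
Proof. by have [{}x <-] := coset_surj x; rewrite !coset_scaleE scalerA. Qed.
Fact coset_scale1 : left_id 1 coset_scale.
Proof. by move=> x; have [{}x <-] := coset_surj x; rewrite coset_scaleE scale1r. Qed.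
Fact coset_scaleDr : right_distributive coset_scale +%R.
Proof.
move=> a x y; have [{}x <-] := coset_surj x; have [{}y <-] := coset_surj y.
by rewrite -cosetD !coset_scaleE scalerDr cosetD.
Qed.
Fact coset_scaleDl x : {morph coset_scale^~ x : a b / a + b}.
Proof.
by move=> a b; have [{}x <-] := coset_surj x; rewrite !coset_scaleE scalerDl cosetD.
Qed.
HB.instance Definition _ := GRing.Zmodule_isLmodule.Build R quotient_module
  coset_scaleA coset_scale1 coset_scaleDr coset_scaleDl.

Fact coset_linear : linear coset.
Proof. by move=> a x y; rewrite cosetD -coset_scaleE. Qed.
HB.instance Definition _ :=
  GRing.isLinear.Build R V quotient_module *:%R coset coset_linear.

End Quotient.

Section Cokernel.
Variables (R : pzRingType) (U V : lmodType R) (d : {linear U -> V}).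

Definition coker : lmodType R := quotient_module (submodule_im d).
Definition coker_proj : {linear V -> coker} := @coset R V _ (submodule_im d).

Lemma coker_surj (y : coker) : exists x, coker_proj x = y.
Proof. exact: coset_surj. Qed.

Lemma coker_ker x : coker_proj x = 0 <-> exists y, d y = x.
Proof.
rewrite -(linear0 coker_proj); have := cosetP (submodule_im d) x 0.
by rewrite subr0.
Qed.

Lemma coker_lift (W : lmodType R) (g : {linear V -> W}) :
  (forall y, g (d y) = 0) ->
  exists h : {linear coker -> W}, forall x, h (coker_proj x) = g x.
Proof.
move=> gd0.
have /choice[r rK] := coker_surj.
have gE x x' : coker_proj x = coker_proj x' -> g x = g x'.
  move=> E; have : coker_proj (x - x') = 0 by rewrite linearB E subrr.
  by case/coker_ker => y yE; apply/eqP; rewrite -subr_eq0 -linearB -yE gd0.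
have hlin : linear (fun z => g (r z)).
  by move=> a x y; rewrite -linearP; apply: gE; rewrite linearP !rK.
by exists (to_linear hlin) => x; rewrite to_linearE; apply: gE; rewrite rK.
Qed.
End Cokernel.

(** * Finitely supported functions and free modules *)

Section FiniteSupport.
Variables (X : eqType) (V : zmodType).

Definition finite_support : {pred X -> V} :=
  fun f => `[< exists s : seq X, forall x, x \notin s -> f x = 0 >].

Lemma finite_supportP f :
  reflect (exists s : seq X, forall x, x \notin s -> f x = 0)
    (f \in finite_support).
Proof. exact: asboolP. Qed.

Fact finite_support_closed : zmod_closed finite_support.
Proof.
split; first by apply/finite_supportP; exists [::].
move=> f g /finite_supportP[s sf] /finite_supportP[t tg]; apply/finite_supportP.
exists (s ++ t) => x; rewrite mem_cat negb_or => /andP[xs xt].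
by rewrite /= !fctE sf // tg // subr0.
Qed.
HB.instance Definition _ :=
  GRing.isZmodClosed.Build (X -> V) finite_support finite_support_closed.

(** The direct sum of copies of V indexed by X.  For V = R this is the free left
    module on X; for a right A-module V it is V (x)_A A^(X). *)
Record fsfun := FSFun { fsval :> X -> V; _ : fsval \in finite_support }.
HB.instance Definition _ := [isSub for fsval].
HB.instance Definition _ := [Choice of fsfun by <:].
HB.instance Definition _ := [SubChoice_isSubZmodule of fsfun by <:].

Lemma fsfunP (f g : fsfun) : (forall x, f x = g x) <-> f = g.
Proof. by split=> [E|-> //]; apply/val_inj/funext. Qed.

Lemma fsfun0E x : (0 : fsfun) x = 0. Proof. by []. Qed.
Lemma fsfunDE (f g : fsfun) x : (f + g) x = f x + g x. Proof. by []. Qed.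
Lemma fsfunNE (f : fsfun) x : (- f) x = - f x. Proof. by []. Qed.

Lemma fsfun_support (f : fsfun) :
  exists2 s : seq X, uniq s & forall x, x \notin s -> f x = 0.
Proof.
have /finite_supportP[s sf] : fsval f \in finite_support by case: f.
by exists (undup s) => [|x]; rewrite ?undup_uniq // mem_undup => /sf.
Qed.

Lemma exists_fsfun (f : X -> V) (s : seq X) : (forall x, x \notin s -> f x = 0) ->
  exists g : fsfun, forall x, g x = f x.
Proof.
move=> sf; have fP : f \in finite_support by apply/finite_supportP; exists s.
by exists (FSFun fP).
Qed.

Fact fsdelta_subproof x (v : V) :
  (fun y => if y == x then v else 0) \in finite_support.
Proof.
by apply/finite_supportP; exists [:: x] => y; rewrite inE => /negbTE->.
Qed.
Definition fsdelta x v := FSFun (fsdelta_subproof x v).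

Lemma fsdeltaE x v y : fsdelta x v y = if y == x then v else 0.
Proof. by []. Qed.

Lemma fsdeltaD x : {morph fsdelta x : v w / v + w}.
Proof.
by move=> v w; apply/fsfunP => y; rewrite fsfunDE !fsdeltaE; case: eqP; rewrite ?addr0.
Qed.

Lemma fsfun_sumE (I : Type) (r : seq I) (F : I -> fsfun) x :
  (\sum_(i <- r) F i) x = \sum_(i <- r) F i x.
Proof.
by elim: r => [|i r IH]; rewrite ?big_nil // !big_cons fsfunDE IH.
Qed.

Lemma fsfun_expand (f : fsfun) (s : seq X) :
  uniq s -> (forall x, x \notin s -> f x = 0) ->
  f = \sum_(x <- s) fsdelta x (f x).
Proof.
move=> s_uniq sf; apply/fsfunP => y; rewrite fsfun_sumE.
have [ys|/[dup]/sf -> ys] := boolP (y \in s); last first.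
  rewrite big_seq big1 // => x xs; rewrite fsdeltaE; case: eqP => // yx.
  by rewrite yx xs in ys.
rewrite (bigD1_seq y) // fsdeltaE eqxx big1 /= ?addr0 // => x xy.
by rewrite eq_sym (negbTE xy).
Qed.

Lemma fsfun_ind (P : fsfun -> Prop) :
  P 0 -> (forall f g, P f -> P g -> P (f + g)) ->
  (forall x v, P (fsdelta x v)) -> forall f, P f.
Proof.
move=> P0 PD Pd f; have [s s_uniq sf] := fsfun_support f.
rewrite (fsfun_expand s_uniq sf).
by elim: (s) => [|x r IH]; rewrite ?big_nil // big_cons; apply: PD.
Qed.
End FiniteSupport.

Section FSLmodule.
Variables (R : pzRingType) (X : eqType) (V : lmodType R).
Implicit Types f : fsfun X V.

Fact fsscale_subproof (a : R) f : (fun x => a *: f x) \in @finite_support X V.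
Proof.
apply/finite_supportP; have [s _ sf] := fsfun_support f.
by exists s => x /sf ->; rewrite scaler0.
Qed.
Definition fsscale a f : fsfun X V := FSFun (fsscale_subproof a f).
Lemma fsscaleE a f x : fsscale a f x = a *: f x.
Proof. by []. Qed.

Fact fsscaleA a b f : fsscale a (fsscale b f) = fsscale (a * b) f.
Proof. by apply/fsfunP => x; rewrite !fsscaleE scalerA. Qed.
Fact fsscale1 : left_id 1 fsscale.
Proof. by move=> f; apply/fsfunP => x; rewrite fsscaleE scale1r. Qed.
Fact fsscaleDr : right_distributive fsscale +%R.
Proof.
by move=> a f g; apply/fsfunP => x; rewrite fsfunDE !fsscaleE fsfunDE scalerDr.
Qed.
Fact fsscaleDl f : {morph fsscale^~ f : a b / a + b}.
Proof.
by move=> a b; apply/fsfunP => x; rewrite fsfunDE !fsscaleE scalerDl.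
Qed.
HB.instance Definition _ := GRing.Zmodule_isLmodule.Build R (fsfun X V)
  fsscaleA fsscale1 fsscaleDr fsscaleDl.

Lemma fsfunZE a f x : (a *: f) x = a *: f x. Proof. by []. Qed.

Lemma fsdeltaZ a x (v : V) : a *: fsdelta x v = fsdelta x (a *: v).
Proof.
by apply/fsfunP => y; rewrite fsfunZE !fsdeltaE; case: eqP; rewrite ?scaler0.
Qed.
End FSLmodule.

Lemma fsdelta_scale (R : pzRingType) (X : eqType) x (a : R) :
  fsdelta x (a : R^o) = a *: fsdelta x (1 : R^o) :> fsfun X R^o.
Proof. by rewrite fsdeltaZ; congr fsdelta; rewrite [RHS]mulr1. Qed.

Section FSExtension.
Variables (X : eqType) (V W : zmodType) (h : X -> V -> W).
Hypothesis hD : forall x, {morph h x : v w / v + w}.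

Let h0 x : h x 0 = 0.
Proof. by apply: (addrI (h x 0)); rewrite -hD !addr0. Qed.

(** The universal property of the direct sum, for additive maps only: it also
    has to serve when V and W are right modules over one ring while the map is
    built from left modules. *)
Lemma fsfun_extend :
  exists H : fsfun X V -> W,
    (forall f g, H (f + g) = H f + H g) /\ (forall x v, H (fsdelta x v) = h x v).
Proof.
have /choice[s sP] : forall f : fsfun X V, exists s : seq X,
    uniq s /\ forall x, x \notin s -> f x = 0.
  by move=> f; have [s s_uniq sf] := fsfun_support f; exists s.
pose H f := \sum_(x <- s f) h x (f x).
have sub_sum (f : fsfun X V) (r t : seq X) : uniq r -> uniq t ->
    {subset r <= t} -> (forall x, x \notin r -> f x = 0) ->
    \sum_(x <- t) h x (f x) = \sum_(x <- r) h x (f x).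
  move=> r_uniq t_uniq rt rf; rewrite (bigID (mem r)) /= [X in _ + X]big1 ?addr0.
    rewrite -big_filter; apply: perm_big; apply: uniq_perm => // [|x].
      exact: filter_uniq.
    by rewrite mem_filter andb_idr //; apply: rt.
  by move=> x /rf ->.
have HE (f : fsfun X V) t : uniq t -> (forall x, x \notin t -> f x = 0) ->
    H f = \sum_(x <- t) h x (f x).
  move=> t_uniq tf; pose u := undup (s f ++ t).
  have [sf_uniq sf] := sP f.
  rewrite /H -(sub_sum f (s f) u) ?undup_uniq //; last first.
    by move=> x; rewrite mem_undup mem_cat => ->.
  rewrite (sub_sum f t u) ?undup_uniq //.
  by move=> x; rewrite mem_undup mem_cat orbC => ->.
exists H; split=> [f g|x v]; last first.
  rewrite (HE _ [:: x]) ?big_seq1 ?fsdeltaE ?eqxx // => y.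
  by rewrite inE fsdeltaE => /negbTE->.
have [[sf_uniq sf] [sg_uniq sg]] := (sP f, sP g).
pose u := undup (s f ++ s g).
have uP x : x \notin u -> (x \notin s f) /\ (x \notin s g).
  by rewrite mem_undup mem_cat negb_or => /andP.
have u_uniq : uniq u := undup_uniq _.
rewrite !(HE _ u) // => [|x /uP[_ /sg]|x /uP[/sf]|x /uP[/sf fx /sg gx]] //.
  by rewrite -big_split; apply: eq_bigr => x _; rewrite fsfunDE hD.
by rewrite fsfunDE fx gx addr0.
Qed.
End FSExtension.

Lemma fsfun_lextend (R : pzRingType) (X : eqType) (W : lmodType R) (g : X -> W) :
  exists H : {linear fsfun X R^o -> W}, forall x (a : R), H (fsdelta x (a : R^o)) = a *: g x.
Proof.
have [H [HD HE]] := @fsfun_extend X R^o W (fun x (a : R) => a *: g x)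
  (fun x a b => scalerDl (g x) a b).
have H0 : H 0 = 0 by apply: (addrI (H 0)); rewrite -HD !addr0.
have Hlin : linear H.
  move=> a u v; rewrite HD; congr (_ + _).
  elim/fsfun_ind: u => [|u w IHu IHw|x b]; first by rewrite scaler0 H0 scaler0.
    by rewrite scalerDr !HD IHu IHw scalerDr.
  by rewrite fsdeltaZ !HE scalerA.
by exists (to_linear Hlin).
Qed.

(** * Projective dimension by successive syzygies *)

Section Homological.
Variable R : pzRingType.
Implicit Types M N P K U V W : lmodType R.

Lemma free_ext (X : eqType) (W : lmodType R) (f g : {linear fsfun X R^o -> W}) :
  (forall x, f (fsdelta x 1) = g (fsdelta x 1)) -> forall v, f v = g v.
Proof.
move=> E; elim/fsfun_ind => [|u w IHu IHw|x a]; first by rewrite !linear0.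
  by rewrite !linearD IHu IHw.
by rewrite fsdelta_scale !linearZ E.
Qed.

Lemma free_lift (X : eqType) U W (f : {linear fsfun X R^o -> W})
    (d : {linear U -> W}) :
  (forall x, exists y, d y = f (fsdelta x 1)) ->
  exists s : {linear fsfun X R^o -> U}, forall v, d (s v) = f v.
Proof.
move=> /choice[g gE]; have [s sE] := fsfun_lextend g; exists s => v.
by apply: (free_ext (f := d \o s)) => x /=; rewrite sE scale1r.
Qed.

Lemma free_projective (X : eqType) : projective (fsfun X R^o : lmodType R).
Proof. by move=> M N g f g_surj; apply: free_lift => x; apply: g_surj. Qed.

Lemma free_cover M :
  exists p : {linear fsfun M R^o -> M}, forall y, exists x, p x = y.
Proof.
have [p pE] := fsfun_lextend (id : M -> M).
by exists p => y; exists (fsdelta y 1); rewrite pE scale1r.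
Qed.

(** Indexing by all of P, with the elements outside the kernel sent to 0, keeps
    the index set a plain type with decidable equality. *)
Lemma free_cover_kernel P N (p : {linear P -> N}) :
  exists (Y : eqType) (d : {linear fsfun Y R^o -> P}),
    forall x, p x = 0 <-> exists y, d y = x.
Proof.
pose g (x : P) := if p x == 0 then x else 0.
have [d dE] := fsfun_lextend g; exists P, d => x.
split=> [px|[y <-]]; first by exists (fsdelta x 1); rewrite dE /g px eqxx scale1r.
elim/fsfun_ind: y => [|y z IHy IHz|y c]; first by rewrite !linear0.
  by rewrite !linearD IHy IHz addr0.
have pg0 : p (g y) = 0 by rewrite /g; case: eqP; rewrite ?linear0.
by rewrite dE linearZ /= pg0 scaler0.
Qed.

(** Lifting needs only that the image of f lie in that of d: over a free module
    lifts are chosen on the basis, and P is a retract of a free module. *)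
Lemma projective_lift P U W (f : {linear P -> W}) (d : {linear U -> W}) :
  projective P -> (forall x, exists y, d y = f x) ->
  exists s : {linear P -> U}, forall x, d (s x) = f x.
Proof.
move=> P_proj fd; have [p p_surj] := free_cover P.
have [s sK] := P_proj _ _ p (idfun : {linear P -> P}) p_surj.
have [t tE] := free_lift (f := f \o p) (d := d) (fun x => fd _).
by exists (t \o s) => x /=; rewrite tE /= sK.
Qed.

Lemma projective_retract P N (a : {linear N -> P}) (b : {linear P -> N}) :
  projective P -> (forall x, b (a x) = x) -> projective N.
Proof.
move=> P_proj ab U W g f g_surj.
have [s sE] := P_proj _ _ g (f \o b) g_surj.
by exists (s \o a) => x /=; rewrite sE /= ab.
Qed.

Definition short_exact K P M (i : {linear K -> P}) (p : {linear P -> M}) :=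
  [/\ injective i, forall y, exists x, p x = y
    & forall x, p x = 0 <-> exists k, i k = x].

(** Removing one syzygy at a time is the form of a finite projective resolution
    that supports induction on its length. *)
Fixpoint projdim_le (n : nat) (M : lmodType R) : Prop :=
  if n is m.+1 then
    exists (P K : lmodType R) (i : {linear K -> P}) (p : {linear P -> M}),
      [/\ projective P, short_exact i p & projdim_le m K]
  else projective M.

Lemma linear_inverse M N (f : {linear M -> N}) :
  injective f -> (forall y, exists x, f x = y) ->
  exists g : {linear N -> M}, cancel f g /\ cancel g f.
Proof.
move=> f_inj /choice[g gK].
have g_lin : linear g by move=> a x y; apply: f_inj; rewrite linearP !gK.
exists (to_linear g_lin); split=> x; last exact: gK.
by apply: f_inj; apply: gK.
Qed.

(** Exactness at V identifies coker d1 with the image of d0, so cokernels can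
    play the part of syzygies. *)
Lemma coker_short_exact U V W M (d1 : {linear U -> V}) (d0 : {linear V -> W})
    (p : {linear W -> M}) :
  (forall x, d0 x = 0 <-> exists y, d1 y = x) ->
  (forall y, exists x, p x = y) -> (forall x, p x = 0 <-> exists y, d0 y = x) ->
  exists i : {linear coker d1 -> W}, short_exact i p.
Proof.
move=> ker_d0 p_surj ker_p.
have [y|i iE] := coker_lift (d := d1) (g := d0); first by apply/ker_d0; exists y.
exists i; split=> // [x x' E|x].
  apply/eqP; rewrite -subr_eq0; apply/eqP.
  have {E} : i (x - x') = 0 by rewrite linearB E subrr.
  have [z <-] := coker_surj (x - x').
  by rewrite iE => /ker_d0/coker_ker.
split=> [/ker_p[y <-]|[k <-]]; first by exists (coker_proj d1 y); rewrite iE.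
by have [z <-] := coker_surj k; rewrite iE; apply/ker_p; exists z.
Qed.

Lemma projdim_le_of_resolution n M :
  has_projective_resolution_of_length M n -> projdim_le n M.
Proof.
elim: n M => [|n IH] M [P [d [e [P_proj P0 e_surj ker_e ker_d]]]].
  have e_inj : injective e.
    move=> x y E; apply/eqP; rewrite -subr_eq0; apply/eqP.
    have /ker_e[z <-] : e (x - y) = 0 by rewrite linearB E subrr.
    by rewrite (P0 1%N _ z) ?linear0.
  have [g [_ gK]] := linear_inverse e_inj e_surj.
  exact: projective_retract (P_proj 0%N) gK.
have [i ip] := coker_short_exact (ker_d 0%N) e_surj ker_e.
exists (P 0%N), (coker (d 1%N)), i, e; split=> //; apply: IH.
exists (fun j => P j.+1), (fun j => d j.+1), (coker_proj (d 1%N)).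
split=> //; first by move=> j jn; apply: P0.
- exact: coker_surj.
- exact: coker_ker.
Qed.

Definition zero_module : lmodType R := fsfun void R^o.
Lemma zero_moduleP (x : zero_module) : x = 0.
Proof. by apply/fsfunP; case. Qed.

Lemma resolution_of_projdim_le n M :
  projdim_le n M -> has_projective_resolution_of_length M n.
Proof.
elim: n M => [|n IH] M.
  move=> M_proj; pose P i : lmodType R := if i is 0%N then M else zero_module.
  pose d i : {linear P i.+1 -> P i} := \0.
  exists P, d, (idfun : {linear M -> M}).
  split=> [[|i]|[|i] // _ x|y|x|i x] //.
  - exact: free_projective.
  - exact: zero_moduleP.
  - by exists y.
  - by split=> [/= -> |[y <-] //]; exists 0.
  - by split=> [_|[y <-]] //; exists 0; rewrite [RHS]zero_moduleP.
case=> Q [K [i [p [Q_proj [i_inj p_surj ker_p] /IH]]]].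
case=> P [d [e [P_proj P0 e_surj ker_e ker_d]]].
pose P' j : lmodType R := if j is j'.+1 then P j' else Q.
pose d' j : {linear P' j.+1 -> P' j} :=
  if j is j'.+1 then d j' else (i \o e).
exists P', d', p; split.
- by case.
- by case=> // j jn; apply: P0.
- exact: p_surj.
- move=> x; split=> [/ker_p[k <-]|[y <-]].
    by have [y <-] := e_surj k; exists y.
  by apply/ker_p; exists (e y).
- case=> [|j] x; last exact: ker_d.
  split=> [/= |[y <-] /=].
    by rewrite -[RHS](linear0 i) => /i_inj/ker_e.
  have /ker_e-> : exists z, d 0%N z = d 0%N y by exists y.
  exact: linear0.
Qed.

Lemma pd_leP M n : projdim_le n M -> enat_le (pd M) (Fin n).
Proof. by move=> /resolution_of_projdim_le; apply: enat_least_le. Qed.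

Lemma pd_finP M : pd M <> Infty -> exists n, pd M = Fin n /\ projdim_le n M.
Proof.
case E: (pd M) => [n|] // _; exists n; split=> //.
by apply: projdim_le_of_resolution; apply: enat_leastP E.
Qed.

(** The identity of N is the sum of a map through N' and a map through a
    projective module, i.e. N is a direct summand of N' (+) T.  This one-sided
    version of stable isomorphism is all that dimension shifting requires. *)
Definition stable_retract N N' :=
  exists (T : lmodType R) (a : {linear N -> N'}) (b : {linear N' -> N})
    (u : {linear N -> T}) (v : {linear T -> N}),
    projective T /\ forall x, x = b (a x) + v (u x).

Lemma stable_retract_of_retract N N' (a : {linear N -> N'}) (b : {linear N' -> N}) :
  cancel a b -> stable_retract N N'.
Proof.
move=> ab; exists zero_module, a, b, \0, \0; split; first exact: free_projective.
by move=> x; rewrite ab addr0.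
Qed.

Lemma projective_stable_retract N N' :
  stable_retract N N' -> projective N' -> projective N.
Proof.
move=> [T [a [b [u [v [T_proj E]]]]]] N'_proj U W g f g_surj.
have [s sE] := N'_proj _ _ g (f \o b) g_surj.
have [t tE] := T_proj _ _ g (f \o v) g_surj.
exists ((s \o a) \+ (t \o u)) => x /=.
by rewrite linearD sE tE /= -linearD -E.
Qed.

(** Schanuel's lemma.  The maps between N and N' lift to the projective covers
    and restrict to the syzygies; on P the identity differs from the lifted
    composite by a map into K, and that map, restricted to K, factors through
    the projective module P. *)
Lemma syzygy_stable_retract K P N K' P' N'
    (i : {linear K -> P}) (p : {linear P -> N})
    (i' : {linear K' -> P'}) (p' : {linear P' -> N'}) :
  short_exact i p -> short_exact i' p' -> projective P -> projective P' ->
  stable_retract N N' -> stable_retract K K'.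
Proof.
move=> [i_inj p_surj ker_p] [i'_inj p'_surj ker_p'] P_proj P'_proj.
move=> [T [a [b [u [v [T_proj E]]]]]].
have [al alE] := P_proj _ _ p' (a \o p) p'_surj.
have [be beE] := P'_proj _ _ p (b \o p') p_surj.
have [w wE] := T_proj _ _ p v p_surj.
have [a' a'E] : exists a' : {linear K -> K'}, forall x, i' (a' x) = al (i x).
  have h x : exists y, i' y = al (i x).
    by apply/ker_p'; rewrite alE /= (_ : p (i x) = 0) ?linear0 //; apply/ker_p; exists x.
  have /choice[r rE] := h.
  have r_lin : linear r by move=> c x y; apply: i'_inj; rewrite linearP !rE !linearP.
  by exists (to_linear r_lin).
have [b' b'E] : exists b' : {linear K' -> K}, forall x, i (b' x) = be (i' x).
  have h x : exists y, i y = be (i' x).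
    by apply/ker_p; rewrite beE /= (_ : p' (i' x) = 0) ?linear0 //; apply/ker_p'; exists x.
  have /choice[r rE] := h.
  have r_lin : linear r by move=> c x y; apply: i_inj; rewrite linearP !rE !linearP.
  by exists (to_linear r_lin).
pose f : {linear P -> P} := idfun \- (be \o al) \- (w \o u \o p).
have [th thE] : exists th : {linear P -> K}, forall x, i (th x) = f x.
  apply: projective_lift => // x; apply/ker_p.
  by rewrite /f /= !linearB /= beE /= alE wE /= {1}[p x]E addrAC addrK subrr.
exists P, a', b', i, th; split=> // x; apply: i_inj.
have pix : p (i x) = 0 by apply/ker_p; exists x.
by rewrite linearD b'E a'E thE /f /= pix !linear0 addr0 addrC subrK.
Qed.

(** In particular the bound can be tested on the syzygies of any projective
    resolution. *)
Lemma projdim_le_stable_retract n N N' :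
  stable_retract N N' -> projdim_le n N' -> projdim_le n N.
Proof.
elim: n N N' => [|n IH] N N' NN'; first exact: projective_stable_retract.
case=> P' [K' [i' [p' [P'_proj ip' K'_le]]]].
have [p p_surj] := free_cover N.
have [Y [d dE]] := free_cover_kernel p.
have [Z [d' d'E]] := free_cover_kernel d.
have [i ip] := coker_short_exact d'E p_surj dE.
exists (fsfun N R^o), (coker d'), i, p; split=> //; first exact: free_projective.
apply: IH K'_le; apply: syzygy_stable_retract ip ip' _ P'_proj NN'.
exact: free_projective.
Qed.

End Homological.

(** * Regular differentials and projective syzygies *)

Section Complexes.
Variable R : pzRingType.
Implicit Types U V W M : lmodType R.

(** Von Neumann regularity.  An equation between linear maps survives every
    additive functor, unlike projectivity of a cokernel. *)
Definition regular_map U V (d : {linear U -> V}) :=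
  exists s : {linear V -> U}, forall x, d (s (d x)) = d x.

(** A section of V -> coker d yields 1 - (section after projection), a map into
    im d, and its lift s satisfies d s d = d.  Conversely 1 - d s vanishes on
    im d and induces a section. *)
Lemma projective_coker U V (d : {linear U -> V}) :
  projective V -> projective (coker d) <-> regular_map d.
Proof.
move=> V_proj; split=> [coker_proj_|[s ds]].
  have [r rE] := coker_proj_ _ _ (coker_proj d) idfun (@coker_surj _ _ _ d).
  pose f : {linear V -> V} := idfun \- (r \o coker_proj d).
  have [x|s sE] := projective_lift (f := f) (d := d) V_proj.
    by apply/coker_ker; rewrite /f /= linearB rE subrr.
  exists s => x; rewrite sE /f /= (_ : coker_proj d (d x) = 0) ?linear0 ?addr0 //.
  by apply/coker_ker; exists x.
pose f : {linear V -> V} := idfun \- (d \o s).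
have [y|h hE] := coker_lift (d := d) (g := f); first by rewrite /f /= ds subrr.
apply: (projective_retract (a := h) (b := coker_proj d)) => // z.
have [x <-] := coker_surj z.
rewrite hE /f /= linearB (_ : coker_proj d (d _) = 0) ?subr0 //.
by apply/coker_ker; exists (s x).
Qed.

Lemma projdim_le_syzygy U V W (d1 : {linear U -> V}) (d0 : {linear V -> W}) n :
  (forall x, d0 x = 0 <-> exists y, d1 y = x) -> projective W ->
  projdim_le n.+1 (coker d0) <-> projdim_le n (coker d1).
Proof.
move=> ker_d0 W_proj.
have [i ip] := coker_short_exact ker_d0 (@coker_surj _ _ _ d0) (@coker_ker _ _ _ d0).
split=> [|K_le]; last by exists W, (coker d1), i, (coker_proj d0).
case=> P [K [j [p [P_proj jp]]]]; apply: projdim_le_stable_retract.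
apply: (syzygy_stable_retract ip jp W_proj P_proj).
exact: (@stable_retract_of_retract _ _ _ idfun idfun).
Qed.

(** A projective resolution may be cut at any point: the n-th syzygy is
    projective as soon as the dimension is at most n. *)
Lemma projdim_le_coker (C : nat -> lmodType R)
    (d : forall i, {linear C i.+1 -> C i}) n :
  (forall i, projective (C i)) ->
  (forall i x, d i x = 0 <-> exists y, d i.+1 y = x) ->
  projdim_le n (coker (d 0%N)) <-> regular_map (d n).
Proof.
elim: n C d => [|n IH] C d C_proj ker_d; first exact: projective_coker.
rewrite (projdim_le_syzygy _ (ker_d 0%N)) //.
by rewrite (IH (fun i => C i.+1) (fun i => d i.+1)).
Qed.

Lemma coker_stable_retract U V M (d : {linear U -> V}) (p : {linear V -> M}) :
  (forall y, exists x, p x = y) -> (forall x, p x = 0 <-> exists y, d y = x) ->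
  stable_retract M (coker d) /\ stable_retract (coker d) M.
Proof.
move=> p_surj ker_p.
have [y|h hE] := coker_lift (d := d) (g := p); first by apply/ker_p; exists y.
have h_inj : injective h.
  move=> z z' E; apply/eqP; rewrite -subr_eq0; apply/eqP.
  have {E} : h (z - z') = 0 by rewrite linearB E subrr.
  by have [x <-] := coker_surj (z - z'); rewrite hE => /ker_p/coker_ker.
have [y|g [hK gK]] := linear_inverse h_inj.
  by have [x <-] := p_surj y; exists (coker_proj d x).
by split; [apply: stable_retract_of_retract gK|apply: stable_retract_of_retract hK].
Qed.

Lemma projdim_le_resolution (C : nat -> lmodType R)
    (d : forall i, {linear C i.+1 -> C i}) M (e : {linear C 0%N -> M}) n :
  (forall i, projective (C i)) ->
  (forall i x, d i x = 0 <-> exists y, d i.+1 y = x) ->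
  (forall y, exists x, e x = y) -> (forall x, e x = 0 <-> exists y, d 0%N y = x) ->
  projdim_le n M <-> regular_map (d n).
Proof.
move=> C_proj ker_d e_surj ker_e; rewrite -(projdim_le_coker n C_proj ker_d).
have [MC CM] := coker_stable_retract e_surj ker_e.
by split; apply: projdim_le_stable_retract.
Qed.

Lemma projdim_leS n M : projdim_le n M -> projdim_le n.+1 M.
Proof.
elim: n M => [|n IH] M.
  move=> M_proj; exists M, (zero_module R), \0, idfun; split=> //.
    split=> [x y _|y|x]; first by rewrite !(zero_moduleP x, zero_moduleP y).
      by exists y.
    by split=> [/= ->|[k <-] //]; exists 0.
  exact: free_projective.
case=> P [K [i [p [P_proj ip /IH K_le]]]].
by exists P, K, i, p.
Qed.

Lemma projdim_leW m n M : (m <= n)%N -> projdim_le m M -> projdim_le n M.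
Proof.
move=> /subnK <-; elim: (n - m)%N => [|j IH] // /IH.
exact: projdim_leS.
Qed.

End Complexes.

(** * Tensor products with free modules and vanishing of Tor *)

Section FSMap.
Variables (X : eqType) (V W : zmodType) (r : V -> W).
Hypothesis r0 : r 0 = 0.

Fact fsmap_subproof (u : fsfun X V) : (fun x => r (u x)) \in @finite_support X W.
Proof.
apply/finite_supportP; have [s _ su] := fsfun_support u.
by exists s => x /su ->.
Qed.
Definition fsmap u : fsfun X W := FSFun (fsmap_subproof u).
Lemma fsmapE u x : fsmap u x = r (u x). Proof. by []. Qed.
Lemma fsmap0 : fsmap 0 = 0.
Proof. by apply/fsfunP => x; rewrite fsmapE r0. Qed.
Lemma fsmapD (rD : {morph r : v w / v + w}) : {morph fsmap : u w / u + w}.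
Proof. by move=> u w; apply/fsfunP => x; rewrite fsfunDE !fsmapE fsfunDE rD. Qed.
Lemma fsmap_delta x v : fsmap (fsdelta x v) = fsdelta x (r v).
Proof. by apply/fsfunP => y; rewrite fsmapE !fsdeltaE; case: eqP. Qed.
End FSMap.

Lemma additive_morph0 (U W : zmodType) (F : U -> W) :
  {morph F : x y / x + y} -> F 0 = 0.
Proof. by move=> FD; apply: (addrI (F 0)); rewrite -FD !addr0. Qed.
Lemma additive_morphB (U W : zmodType) (F : U -> W) :
  {morph F : x y / x + y} -> {morph F : x y / x - y}.
Proof.
by move=> FD x y; apply: (addIr (F y)); rewrite -FD !subrK.
Qed.
Lemma additive_morph_sum (U W : zmodType) (F : U -> W) (I : Type) (s : seq I) (G : I -> U) :
  {morph F : x y / x + y} -> F (\sum_(i <- s) G i) = \sum_(i <- s) F (G i).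
Proof. by move=> FD; apply: big_morph => //; apply: additive_morph0. Qed.

Section Tensor.
Variable A : pzRingType.
Implicit Types V W K P : lmodType A^c.
Implicit Types X Y Z : eqType.

Section Pure.
Variables (X : eqType) (V : lmodType A^c).

(** The pure tensor v (x) g of V (x)_A A^(X) = V^(X). *)
Definition tens (v : V) (g : fsfun X A^o) : fsfun X V :=
  fsmap (r := fun a : A^o => (a : A^c) *: v) (scale0r v) g.

Lemma tensE v g x : tens v g x = (g x : A^c) *: v. Proof. by []. Qed.

Lemma tensDl g : {morph tens^~ g : v w / v + w}.
Proof. by move=> v w; apply/fsfunP => x; rewrite fsfunDE !tensE scalerDr. Qed.
Lemma tensDr v : {morph tens v : g h / g + h}.
Proof. by move=> g h; apply/fsfunP => x; rewrite fsfunDE !tensE -scalerDl. Qed.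
Lemma tens0r v : tens v 0 = 0. Proof. exact: fsmap0. Qed.
Lemma tensA v (a : A) g : tens ((a : A^c) *: v) g = tens v (a *: g).
Proof. by apply/fsfunP => x; rewrite !tensE scalerA. Qed.
Lemma tens_delta x a v : tens v (fsdelta x a) = fsdelta x ((a : A^c) *: v).
Proof. exact: fsmap_delta. Qed.

Lemma tens_ind (Q : fsfun X V -> Prop) :
  Q 0 -> (forall u w, Q u -> Q w -> Q (u + w)) -> (forall x v, Q (tens v (fsdelta x 1))) ->
  forall u, Q u.
Proof.
move=> Q0 QD Qt; apply: fsfun_ind => // x v.
by have := Qt x v; rewrite tens_delta scale1r.
Qed.
End Pure.

Section TensorMap.
Variables (X Y : eqType) (V : lmodType A^c) (f : {linear fsfun X A^o -> fsfun Y A^o}).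

(** The map V (x) f on V^(X), prescribed on v (x) (basis element). *)
Fact tensor_map_exists : exists H : fsfun X V -> fsfun Y V,
  (forall u w, H (u + w) = H u + H w) /\
  (forall x v, H (fsdelta x v) = tens v (f (fsdelta x 1))).
Proof. by apply: fsfun_extend => x; apply: tensDl. Qed.
Definition tensor_map : fsfun X V -> fsfun Y V := sval (cid tensor_map_exists).

Lemma tensor_mapD : {morph tensor_map : u w / u + w}.
Proof. exact: (svalP (cid tensor_map_exists)).1. Qed.
Lemma tensor_map_delta x v : tensor_map (fsdelta x v) = tens v (f (fsdelta x 1)).
Proof. exact: (svalP (cid tensor_map_exists)).2. Qed.
Lemma tensor_map0 : tensor_map 0 = 0.
Proof. exact: additive_morph0 tensor_mapD. Qed.

Lemma tensor_map_tens v g : tensor_map (tens v g) = tens v (f g).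
Proof.
elim/fsfun_ind: g => [|g h IHg IHh|x a].
- by rewrite linear0 !tens0r tensor_map0.
- by rewrite linearD !tensDr tensor_mapD IHg IHh.
rewrite tens_delta tensor_map_delta tensA -linearZ fsdeltaZ.
by congr (tens _ (f (fsdelta _ _))); apply: mulr1.
Qed.
End TensorMap.

Lemma tensor_map_comp X Y Z V (f : {linear fsfun Y A^o -> fsfun Z A^o})
    (g : {linear fsfun X A^o -> fsfun Y A^o}) (h : {linear fsfun X A^o -> fsfun Z A^o}) :
  (forall x, f (g x) = h x) ->
  forall u : fsfun X V, tensor_map f (tensor_map g u) = tensor_map h u.
Proof.
move=> E; elim/tens_ind => [|u w IHu IHw|x v].
- by rewrite !tensor_map0.
- by rewrite !tensor_mapD IHu IHw.
by rewrite !tensor_map_tens E.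
Qed.

Lemma tensor_map_zero X Y V (h : {linear fsfun X A^o -> fsfun Y A^o}) :
  (forall x, h x = 0) -> forall u : fsfun X V, tensor_map h u = 0.
Proof.
move=> h0; elim/tens_ind => [|u w IHu IHw|x v].
- by rewrite tensor_map0.
- by rewrite tensor_mapD IHu IHw addr0.
by rewrite tensor_map_tens h0 tens0r.
Qed.

Lemma tensor_map_natural X Y V W (r : {linear V -> W})
    (f : {linear fsfun X A^o -> fsfun Y A^o}) (u : fsfun X V) :
  fsmap (linear0 r) (tensor_map f u) = tensor_map f (fsmap (linear0 r) u).
Proof.
have rD : {morph r : v w / v + w} by exact: linearD.
have tE Z (v : V) (g : fsfun Z A^o) : fsmap (linear0 r) (tens v g) = tens (r v) g.
  by apply/fsfunP => x; rewrite fsmapE !tensE linearZ.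
elim/tens_ind: u => [|u w IHu IHw|x v].
- by rewrite tensor_map0 !fsmap0 tensor_map0.
- by rewrite tensor_mapD !fsmapD // tensor_mapD IHu IHw.
by rewrite tE !tensor_map_tens tE.
Qed.

(** For consecutive differentials of a free resolution of M this is the
    vanishing of Tor^A(V, M) in the degree of A^(Y). *)
Definition tensor_exact X Y Z V (f : {linear fsfun X A^o -> fsfun Y A^o})
    (g : {linear fsfun Y A^o -> fsfun Z A^o}) :=
  forall u : fsfun Y V, tensor_map g u = 0 -> exists w : fsfun X V, tensor_map f w = u.

(** Projective modules are flat.  By a dual basis, a tensor u is the sum of the
    w (x) (h_w u) over finitely many w in V, where h_w is the w-th coordinate of
    a section of the free cover of V.  Each h_w u is a cycle over A, hence a
    boundary. *)
Lemma projective_tensor_exact X Y Z V (f : {linear fsfun X A^o -> fsfun Y A^o})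
    (g : {linear fsfun Y A^o -> fsfun Z A^o}) :
  projective V -> (forall x, g x = 0 -> exists y, f y = x) -> tensor_exact V f g.
Proof.
move=> V_proj ker_g u gu0.
have [p pE] := fsfun_lextend (id : V -> V).
have [|h hK] := V_proj _ _ p idfun.
  by move=> y; exists (fsdelta y 1); rewrite pE scale1r.
(* the coordinate functionals of the dual basis *)
pose r (w v : V) : A^o := h v w.
have r0 w : r w 0 = 0 by rewrite /r linear0.
have rD w : {morph r w : v v' / v + v'} by move=> v v'; rewrite /r linearD.
have rE T w v (k : fsfun T A^o) : fsmap (r0 w) (tens v k) = (r w v : A) *: k.
  by apply/fsfunP => x; rewrite fsmapE tensE /r linearZ.
have r_nat w (v : fsfun Y V) : fsmap (r0 w) (tensor_map g v) = g (fsmap (r0 w) v).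
  elim/tens_ind: v => [|v v' IHv IHv'|x v].
  - by rewrite tensor_map0 !fsmap0 linear0.
  - by rewrite tensor_mapD !fsmapD // linearD IHv IHv'.
  by rewrite tensor_map_tens !rE linearZ.
(* Asking for the expansion over every larger index list makes it additive in u. *)
have u_expand : exists s0 : seq V, forall s : seq V, uniq s -> {subset s0 <= s} ->
    u = \sum_(w <- s) tens w (fsmap (r0 w) u).
  elim/fsfun_ind: (u) => [|v v' [s1 IH1] [s2 IH2]|x v].
  - by exists [::] => s _ _; rewrite big1 // => w _; rewrite fsmap0 tens0r.
  - exists (s1 ++ s2) => s s_uniq ss.
    rewrite {1}(IH1 s) // => [|w ws]; last by apply: ss; rewrite mem_cat ws.
    rewrite {1}(IH2 s) // => [|w ws]; last by apply: ss; rewrite mem_cat ws orbT.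
    by rewrite -big_split; apply: eq_bigr => w _; rewrite fsmapD // tensDr.
  have [s0 _ hv] := fsfun_support (h v).
  exists s0 => s s_uniq ss.
  have vE : v = \sum_(w <- s) (h v w : A^c) *: w.
    have /(fsfun_expand s_uniq) hE : forall w, w \notin s -> h v w = 0.
      by move=> w ws; apply: hv; apply: contra ws; apply: ss.
    by rewrite -{1}[v]hK {1}hE linear_sum; apply: eq_bigr => w _; rewrite pE.
  rewrite {1}vE additive_morph_sum; last exact: fsdeltaD.
  by apply: eq_bigr => w _; rewrite fsmap_delta tens_delta.
have [s0 /(_ (undup s0) (undup_uniq _))->] := u_expand; last first.
  by move=> w; rewrite mem_undup.
elim: (undup s0) => [|w s [z IH]].
  by exists 0; rewrite big_nil tensor_map0.
have [y yE] : exists y, f y = fsmap (r0 w) u.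
  by apply: ker_g; rewrite -r_nat gu0 fsmap0.
exists (tens w y + z).
by rewrite big_cons tensor_mapD IH tensor_map_tens yE.
Qed.

(** The connecting map of the long exact sequence: a cycle over V lifts to P,
    and the differential of the lift is a cycle over K.  Being a boundary there,
    it can be used to correct the lift into a cycle over P. *)
Lemma tensor_exact_shift (X3 X2 X1 X0 : eqType) K P V
    (d2 : {linear fsfun X3 A^o -> fsfun X2 A^o})
    (d1 : {linear fsfun X2 A^o -> fsfun X1 A^o})
    (d0 : {linear fsfun X1 A^o -> fsfun X0 A^o})
    (i : {linear K -> P}) (p : {linear P -> V}) :
  (forall x, d0 (d1 x) = 0) -> short_exact i p ->
  tensor_exact P d2 d1 -> tensor_exact K d1 d0 -> tensor_exact V d2 d1.
Proof.
move=> d01 [i_inj p_surj ker_p] P_ex K_ex u u0.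
have pD : {morph p : x y / x + y} by exact: linearD.
have [U UE] : exists U : fsfun X2 P, fsmap (linear0 p) U = u.
  elim/fsfun_ind: (u) => [|v w [V1 <-] [W1 <-]|x v].
  - by exists 0; rewrite fsmap0.
  - by exists (V1 + W1); rewrite fsmapD.
  by have [y <-] := p_surj v; exists (fsdelta x y); rewrite fsmap_delta.
have [w wE] : exists w : fsfun X1 K, fsmap (linear0 i) w = tensor_map d1 U.
  have E x : p (tensor_map d1 U x) = 0.
    by rewrite -(fsmapE (linear0 p)) tensor_map_natural UE u0.
  have /choice[k kE] : forall x, exists k, i k = tensor_map d1 U x.
    by move=> x; apply/ker_p.
  have [s _ sU] := fsfun_support (tensor_map d1 U).
  have [x xs|w wk] := exists_fsfun (f := k) (s := s).
    by apply: i_inj; rewrite kE linear0 sU.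
  by exists w; apply/fsfunP => x; rewrite fsmapE wk kE.
have [|w' w'E] := K_ex w.
  apply/fsfunP => x; apply: i_inj; rewrite linear0 -(fsmapE (linear0 i)).
  rewrite tensor_map_natural wE.
  rewrite (tensor_map_comp (h := d0 \o d1)) // tensor_map_zero //.
have [|z zE] := P_ex (U - fsmap (linear0 i) w').
  rewrite (additive_morphB (@tensor_mapD _ _ _ _)) -tensor_map_natural w'E wE.
  by rewrite subrr.
exists (fsmap (linear0 p) z); rewrite -tensor_map_natural zE.
rewrite (additive_morphB (fsmapD _ pD)) UE.
suff -> : fsmap (linear0 p) (fsmap (linear0 i) w') = 0 by rewrite subr0.
by apply/fsfunP => x; rewrite !fsmapE; apply/ker_p; exists (w' x).
Qed.

(** Tor_i^A(V, -) vanishes for i > n when V has projective dimension at most n;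
    here i.+1 is the degree. *)
Lemma projdim_tensor_exact (X : nat -> eqType)
    (d : forall i, {linear fsfun (X i.+1) A^o -> fsfun (X i) A^o}) V n :
  (forall i x, d i x = 0 <-> exists y, d i.+1 y = x) ->
  projdim_le n V -> forall i, (n <= i)%N -> tensor_exact V (d i.+1) (d i).
Proof.
move=> ker_d; elim: n V => [|n IH] V.
  by move=> V_proj i _; apply: projective_tensor_exact => // x /ker_d.
case=> P [K [i0 [p [P_proj ip K_le]]]] [|j] // nj.
apply: (tensor_exact_shift (d0 := d j) _ ip).
- by move=> x; apply/ker_d; exists x.
- by apply: projective_tensor_exact => // x /ker_d.
exact: IH.
Qed.

End Tensor.

(** * The Jacobson radical *)

Section Zorn.
Variables (R : pzRingType) (V : lmodType R).

(** The common source of maximal left ideals (avoid 1) and of complements (avoid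
    the nonzero elements of a submodule). *)
Lemma maximal_submodule_avoiding (W Q : V -> Prop) :
  submodule W -> (forall x, W x -> ~ Q x) ->
  exists U : V -> Prop,
    [/\ submodule U, forall x, W x -> U x, forall x, U x -> ~ Q x
      & forall U' : V -> Prop, submodule U' -> (forall x, U x -> U' x) ->
          (forall x, U' x -> ~ Q x) -> forall x, U' x -> U x].
Proof.
move=> W_sub WQ.
(* Adjoining W to every set of the family lets the empty chain have a bound. *)
pose hull (A : set V) := fun x => W x \/ A x.
pose P (A : set V) := submodule (hull A) /\ (forall x, hull A x -> ~ Q x).
have [F FP F_tot|A [[A_sub AQ] A_max]] := @Zorn_bigcup V P.
  have common x y : hull (\bigcup_(X in F) X)%classic x ->
      hull (\bigcup_(X in F) X)%classic y ->
      (W x /\ W y) \/ exists X, [/\ F X, hull X x & hull X y].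
    case=> [Wx|[X FX Xx]] [Wy|[Y FY Yy]].
    - by left.
    - by right; exists Y; split=> //; [left|right].
    - by right; exists X; split=> //; [right|left].
    right; have [XY|YX] := F_tot X Y FX FY.
      by exists Y; split=> //; right=> //; apply: XY.
    by exists X; split=> //; right=> //; apply: YX.
  split.
    split=> [|a x y Hx Hy]; first by left; apply: submodule0 W_sub.
    have [[Wx Wy]|[X [FX Xx Xy]]] := common _ _ Hx Hy.
      by left; apply: W_sub.2.
    by have [Wz|Xz] := (FP _ FX).1.2 a _ _ Xx Xy; [left|right; exists X].
  move=> x Hx; have [[Wx _]|[X [FX Xx _]]] := common _ _ Hx Hx; first exact: WQ.
  exact: (FP _ FX).2.
exists (hull A); split=> // [x Wx|U' U'_sub AU' U'Q x U'x]; first by left.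
apply: contrapT => Ax; have hullU' : hull U' = U'.
  apply/funext => y; apply/propext; split=> [[Wy|//]|]; last by right.
  by apply: AU'; left.
apply: (A_max U'); last by rewrite /P hullU'.
by split=> [y Ay|/(_ _ U'x) A'x]; [apply: AU'; right|apply: Ax; right].
Qed.
End Zorn.

Section Jacobson.
Variable R : pzRingType.
Implicit Types x y a b c : R.

Lemma left_idealE (I : {pred R}) :
  left_ideal I <-> submodule (fun x : R^o => x \in I).
Proof. by split=> -[h0 h]; split=> // a x y xI yI; apply: h. Qed.

(** Otherwise I + R x would be a proper left ideal strictly above I. *)
Lemma maximal_left_ideal_add (I : {pred R}) x :
  maximal_left_ideal I -> x \notin I ->
  forall y, exists i a, i \in I /\ y = i + a * x.
Proof.
move=> [/left_idealE I_sub _ I_max] xI y.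
pose K : {pred R} := fun y => `[< exists i a, i \in I /\ y = i + a * x >].
have KP z : reflect (exists i a, i \in I /\ z = i + a * x) (z \in K).
  exact: asboolP.
apply/KP/negPn/negP => yK; case/negP: xI; apply: (I_max K) => //.
- apply/left_idealE; split.
    by apply/KP; exists 0, 0; rewrite mul0r addr0; split=> //; apply: submodule0 I_sub.
  move=> a _ _ /KP[i [b [iI ->]]] /KP[j [c [jI ->]]]; apply/KP.
  exists (a * i + j), (a * b + c); split; first exact: I_sub.2.
  by rewrite [a *: _]mulrDr mulrDl mulrA addrACA.
- by move=> i iI; apply/KP; exists i, 0; rewrite mul0r addr0.
- by exists y.
by apply/KP; exists 0, 1; rewrite mul1r add0r; split=> //; apply: submodule0 I_sub.
Qed.

(** If 1 - a x has no left inverse, a maximal left ideal contains R (1 - a x),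
    and with x it would contain 1.  If x lies outside a maximal left ideal I,
    then 1 = i + a x with i in I, and i = 1 - a x cannot be left invertible. *)
Lemma jacobson_left_inv x :
  jacobson_radical x <-> forall a, exists c, c * (1 - a * x) = 1.
Proof.
split=> [xJ a|x_inv I I_max]; last first.
  apply: contrapT => /negP xI.
  have [/left_idealE I_sub [z zI] _] := I_max.
  have [i [a [iI E]]] := maximal_left_ideal_add I_max xI 1.
  have [c cE] := x_inv a.
  have iE : 1 - a * x = i by rewrite {1}E addrK.
  case/negP: zI; rewrite -[z]mulr1 -cE iE mulrA.
  exact: (submoduleZ (S := fun x : R^o => x \in I) (z * c) I_sub).
pose W (y : R^o) := exists c, c * (1 - a * x) = y.
have W_sub : submodule W.
  split; first by exists 0; rewrite mul0r.
  by move=> b _ _ [c <-] [d <-]; exists (b * c + d); rewrite mulrDl -mulrA.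
apply: contrapT => W1.
have [|U [U_sub WU U1 U_max]] := @maximal_submodule_avoiding _ R^o W (fun y => y = 1) W_sub.
  by move=> y [c cE] y1; apply: W1; exists c; rewrite cE.
pose I : {pred R} := fun y => `[< U y >].
have IP y : reflect (U y) (y \in I) by exact: asboolP.
have I_max : maximal_left_ideal I.
  split=> [||K /left_idealE K_sub IK [z zK]].
  - apply/left_idealE; split; first by apply/IP; apply: submodule0 U_sub.
    by move=> b y z /IP Uy /IP Uz; apply/IP; apply: U_sub.2.
  - by exists 1; apply/IP => /U1.
  move=> y yK; apply/IP; move: y yK.
  apply: (U_max (fun y : R^o => y \in K)) => // [y Uy|y yK y1].
    by apply: IK; apply/IP.
  case/negP: zK; rewrite -[z]mulr1 -y1.
  exact: (submoduleZ (S := fun x : R^o => x \in K) z K_sub).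
have /IP Ux := xJ I I_max.
apply: (U1 1) => //; rewrite -[1](subrK (a * x)) addrC.
apply: U_sub.2 => //; apply: WU; exists 1; exact: mul1r.
Qed.

(** A left inverse c of 1 - b a x produces the left inverse 1 + a x c b of
    1 - a x b.  A left inverse of 1 - a x b has again the form 1 - a' x b, hence
    is left invertible too, and so is a two-sided inverse.  This makes the
    characterization of the radical independent of the side. *)
Lemma jacobson_inv x a b : jacobson_radical x ->
  exists c, c * (1 - a * x * b) = 1 /\ (1 - a * x * b) * c = 1.
Proof.
move/jacobson_left_inv => x_inv.
have linv a' b' : exists c, c * (1 - a' * x * b') = 1.
  have [c cE] := x_inv (b' * a'); exists (1 + a' * x * c * b').
  have E : c * (b' * a' * x) = c - 1 by rewrite -cE mulrBr mulr1 opprB addrC subrK.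
  rewrite mulrBr mulr1 mulrDl mul1r.
  have -> : a' * x * c * b' * (a' * x * b') = a' * x * (c * (b' * a' * x)) * b'.
    by rewrite !mulrA.
  by rewrite E mulrBr mulrBl mulr1 [a' * x * b' + _]addrC subrK addrK.
have [c cE] := linv a b; exists c; split=> //.
have [d dE] := linv (- c * a) b.
have E : 1 - (- c * a) * x * b = c.
  rewrite !mulNr opprK -{1}cE mulrBr mulr1 -!mulrA.
  by rewrite subrK.
rewrite E in dE; suff <- : d = 1 - a * x * b by [].
by rewrite -[LHS]mulr1 -{1}cE mulrA dE mul1r.
Qed.

Lemma jacobsonP x :
  jacobson_radical x <-> forall a b, exists c, c * (1 - a * x * b) = 1.
Proof.
split=> [xJ a b|h]; first by have [c []] := jacobson_inv a b xJ; exists c.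
by apply/jacobson_left_inv => a; have [c] := h a 1; rewrite mulr1; exists c.
Qed.

Lemma jacobsonM x a b : jacobson_radical x -> jacobson_radical (a * x * b).
Proof.
move=> xJ; apply/jacobsonP => c d; have [e [E _]] := jacobson_inv (c * a) (b * d) xJ.
by exists e; rewrite -[RHS]E !mulrA.
Qed.

Lemma jacobsonMl x a : jacobson_radical x -> jacobson_radical (a * x).
Proof. by move=> /(jacobsonM a 1); rewrite mulr1. Qed.
Lemma jacobsonMr x b : jacobson_radical x -> jacobson_radical (x * b).
Proof. by move=> /(jacobsonM 1 b); rewrite mul1r. Qed.

Lemma jacobson_submodule : submodule (@jacobson_radical R : R^o -> Prop).
Proof.
split=> [I [/left_idealE I_sub _ _]|a x y xJ yJ I I_max].
  exact: submodule0 I_sub.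
have [/left_idealE I_sub _ _] := I_max.
exact: (I_sub.2 a x y (xJ _ I_max) (yJ _ I_max)).
Qed.

Lemma jacobson0 : jacobson_radical (0 : R).
Proof. exact: submodule0 jacobson_submodule. Qed.
Lemma jacobsonD x y : jacobson_radical x -> jacobson_radical y -> jacobson_radical (x + y).
Proof. exact: submoduleD jacobson_submodule. Qed.
End Jacobson.

Lemma jacobson_converse (R : pzRingType) (x : R) :
  jacobson_radical (x : R^c) -> jacobson_radical x.
Proof.
move=> xJ; apply/jacobsonP => a b.
have [c [_ E]] := @jacobson_inv R^c x b a xJ.
by exists c; rewrite -mulrA; exact: E.
Qed.

(** * Artinian rings *)

Section ChainCondition.
Variables (R : pzRingType) (V : lmodType R).

Definition dcc_in (T : V -> Prop) :=
  forall S : nat -> V -> Prop, (forall n, submodule (S n)) ->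
    (forall n x, S n x -> T x) -> (forall n x, S n.+1 x -> S n x) ->
    exists N, forall n x, (N <= n)%N -> S N x -> S n x.

Definition dcc := dcc_in (fun _ => True).

Lemma decreasing_le (S : nat -> V -> Prop) : (forall n x, S n.+1 x -> S n x) ->
  forall m n x, (m <= n)%N -> S n x -> S m x.
Proof.
move=> S_dec m n x /subnK <-; elim: (n - m)%N => [|j IH] // Sx.
by apply/IH/S_dec.
Qed.

(** The minimum condition: without a minimal member, choosing ever smaller ones
    gives a strictly descending chain. *)
Lemma dcc_minimal (F : (V -> Prop) -> Prop) (S0 : V -> Prop) : dcc ->
  (forall S, F S -> submodule S) -> F S0 ->
  exists2 S, F S & forall S', F S' -> (forall x, S' x -> S x) -> forall x, S x -> S' x.
Proof.
move=> V_dcc F_sub FS0; apply: contrapT => no_min.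
have step (S : {S | F S}) : exists S' : {S | F S},
    (forall x, sval S' x -> sval S x) /\ ~ (forall x, sval S x -> sval S' x).
  apply: contrapT => S_min; apply: no_min; exists (sval S); first exact: svalP S.
  by move=> S' FS' S'S; apply: contrapT => SS'; apply: S_min; exists (exist _ S' FS').
have [f fP] := choice step.
pose C n := iter n f (exist _ S0 FS0).
have [|||N NP] := V_dcc (fun n => sval (C n)) => //.
- by move=> n; apply: F_sub; apply: svalP (C n).
- by move=> n x; apply: (fP (C n)).1.
by apply: (fP (C N)).2 => x; apply: (NP N.+1).
Qed.

Fixpoint generated (g : seq V) (x : V) : Prop :=
  if g is v :: g' then exists (c : R) y, generated g' y /\ x = c *: v + y else x = 0.

Lemma generated_submodule g : submodule (generated g).
Proof.
elim: g => [|v g [IH0 IH]]; first by split=> [//|a x y /= -> ->]; rewrite scaler0 addr0.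
split=> [|a _ _ /= [c [y [gy ->]]] [d [z [gz ->]]]].
  by exists 0, 0; rewrite scale0r addr0.
exists (a * c + d), (a *: y + z); split; first exact: IH.
by rewrite scalerDr scalerA scalerDl addrACA.
Qed.

Lemma generated_mem g v : v \in g -> generated g v.
Proof.
elim: g => //= w g IH; rewrite inE => /predU1P[->|/IH gv].
  by exists 1, 0; rewrite scale1r addr0; split=> //; apply: submodule0 (generated_submodule g).
by exists 0, v; rewrite scale0r add0r.
Qed.

Lemma generated_sub g (S : V -> Prop) : submodule S ->
  (forall v, v \in g -> S v) -> forall x, generated g x -> S x.
Proof.
move=> S_sub; elim: g => [|v g IH] gS x /=; first by move->; apply: submodule0 S_sub.
case=> c [y [gy ->]]; apply: S_sub.2; first by apply: gS; apply: mem_head.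
by apply: IH gy => w wg; apply: gS; rewrite inE wg orbT.
Qed.

Lemma finitely_generatedP :
  finitely_generated V <-> exists g : seq V, forall x, generated g x.
Proof.
split=> [[n [g gP]]|[g gP]].
  exists (codom g) => x; have [c ->] := gP x.
  apply: submodule_sum => [|i]; first exact: generated_submodule.
  apply: submoduleZ; first exact: generated_submodule.
  by apply: generated_mem; apply: codom_f.
exists (size g), (tnth (in_tuple g)) => x.
apply: (@generated_sub g (fun x => exists c : 'I_(size g) -> R,
  x = \sum_i c i *: tnth (in_tuple g) i)) (gP x).
  split; first by exists (fun=> 0); rewrite big1 // => i _; rewrite scale0r.
  move=> a _ _ [c ->] [d ->]; exists (fun i => a * c i + d i).
  by rewrite scaler_sumr -big_split; apply: eq_bigr => i _; rewrite scalerDl scalerA.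
move=> v; rewrite -[g in v \in g]/(val (in_tuple g)) => /tnthP[i ->].
exists (fun j => (j == i)%:R); rewrite (bigD1 i) //= eqxx scale1r.
by rewrite big1 ?addr0 // => j /negbTE ->; rewrite scale0r.
Qed.
End ChainCondition.

(** By induction on the generators v :: g.  A submodule is controlled by its
    intersection with the span of g together with the ideal of coefficients at v
    of its elements; along a chain both become stationary. *)
Lemma dcc_finitely_generated (R : pzRingType) (V : lmodType R) :
  dcc R^o -> finitely_generated V -> dcc V.
Proof.
move=> R_dcc /finitely_generatedP[g gP].
suff: dcc_in (generated g) by move=> gd S S_sub _; apply: gd.
elim: g {gP} => [|v g IH] S S_sub Sg S_dec.
  by exists 0%N => n x _ /Sg ->; apply: submodule0 (S_sub n).
have g_sub := generated_submodule g.
have [|||N1 N1P] := IH (fun n x => S n x /\ generated g x).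
- move=> n; split; first by split; [apply: submodule0 (S_sub n)|apply: submodule0 g_sub].
  by move=> a x y [Sx gx] [Sy gy]; split; [apply: (S_sub n).2|apply: g_sub.2].
- by move=> n x [].
- by move=> n x [/S_dec].
pose I n c := exists2 y, generated g y & S n (c *: v + y).
have [|//||N2 N2P] := R_dcc I.
- move=> n; split.
    by exists 0; rewrite ?scale0r ?addr0; [apply: submodule0 g_sub|apply: submodule0 (S_sub n)].
  move=> a c d [y gy Sy] [z gz Sz]; exists (a *: y + z); first exact: g_sub.2.
  have := (S_sub n).2 a _ _ Sy Sz.
  suff -> : a *: ((c : R) *: v + y) + ((d : R) *: v + z) =
    (a * (c : R) + (d : R)) *: v + (a *: y + z) by [].
  by rewrite scalerDl scalerDr scalerA addrACA.
- by move=> n c [y gy /S_dec Sy]; exists y.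
pose N := maxn N1 N2; exists N => n x Nn SNx.
have [c [y [gy xE]]] := Sg _ _ SNx.
have Sdec := decreasing_le S_dec.
have [|z gz Sz] := N2P n c (leq_trans (leq_maxr _ _) Nn).
  by exists y => //; rewrite -xE; apply: Sdec SNx; apply: leq_maxr.
have [|Sxz _] := N1P n (x - (c *: v + z)) (leq_trans (leq_maxl _ _) Nn).
  split; last by rewrite xE opprD addrACA subrr add0r; apply: submoduleB g_sub _ _.
  apply: submoduleB; [exact: S_sub|apply: Sdec SNx; exact: leq_maxl|].
  apply: Sdec Sz; exact: leq_trans (leq_maxl _ _) Nn.
by rewrite -[x](subrK (c *: v + z)); apply: submoduleD (S_sub n) _ _.
Qed.

Section RadicalPowers.
Variables (R : pzRingType) (J : R -> Prop).
Hypothesis J_ideal : submodule (J : R^o -> Prop).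

(** The product J S of an ideal and a submodule. *)
Inductive ideal_mul (V : lmodType R) (S : V -> Prop) : V -> Prop :=
| ideal_mul0 : ideal_mul S 0
| ideal_mulD a x y : J a -> S x -> ideal_mul S y -> ideal_mul S (a *: x + y).

Lemma ideal_mul_submodule (V : lmodType R) (S : V -> Prop) : submodule (ideal_mul S).
Proof.
split=> [|c x y Sx Sy]; first exact: ideal_mul0.
elim: Sx => [|a u w Ja Su _ IH]; first by rewrite scaler0 add0r.
rewrite scalerDr scalerA -addrA; apply: ideal_mulD => //.
exact: (submoduleZ c J_ideal).
Qed.

Lemma ideal_mul_gen (V : lmodType R) (S : V -> Prop) a x :
  J a -> S x -> ideal_mul S (a *: x).
Proof. by move=> Ja Sx; rewrite -[_ *: _]addr0; apply: ideal_mulD => //; apply: ideal_mul0. Qed.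

Lemma ideal_mul_sub (V : lmodType R) (S T : V -> Prop) : submodule T ->
  (forall a x, J a -> S x -> T (a *: x)) -> forall x, ideal_mul S x -> T x.
Proof.
move=> T_sub ST x; elim=> [|a u w Ja Su _ IH]; first exact: submodule0.
by apply: submoduleD => //; apply: ST.
Qed.

Lemma iter_ideal_mul_submodule (V : lmodType R) (S : V -> Prop) n :
  submodule S -> submodule (iter n (@ideal_mul V) S).
Proof. by case: n => [|n] // _; apply: ideal_mul_submodule. Qed.

Local Notation Jpow n := (iter n (@ideal_mul R^o) (fun _ => True)).

(** J^n S is spanned by the products a x with a in J^n and x in S; here this is
    phrased by annihilation instead of by sums of products. *)
Lemma iter_ideal_mul_kill (V W : lmodType R) (f : {linear V -> W}) (S : V -> Prop) n (c : R) :
  (forall (a : R) x, Jpow n a -> S x -> c *: (a *: f x) = 0) ->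
  forall x, iter n (@ideal_mul V) S x -> c *: f x = 0.
Proof.
elim: n c => [|n IH] c cS x /=; first by move=> /(cS 1 x I); rewrite scale1r.
elim=> [|a y z Ja Sy _ IHz]; first by rewrite linear0 scaler0.
rewrite linearD linearZ scalerDr IHz addr0 scalerA.
apply: IH Sy => b w Jb Sw; rewrite -scalerA [a *: _]scalerA.
exact: (cS (a * b) w (ideal_mul_gen (V := R^o) Ja Jb) Sw).
Qed.

Lemma iter_ideal_mul_pow0 n (V : lmodType R) (S : V -> Prop) :
  (forall a, Jpow n a -> a = 0) -> forall x, iter n (@ideal_mul V) S x -> x = 0.
Proof.
move=> J0 x Sx; rewrite -[x]scale1r.
apply: (iter_ideal_mul_kill (f := idfun) _ Sx) => a y /J0 -> _.
by rewrite scale0r scaler0.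
Qed.

(** Semisimplicity of R/J: modulo J every left ideal is generated by an
    idempotent e, which acts on it as a right identity. *)
Definition idempotent_mod :=
  forall I : R -> Prop, submodule (I : R^o -> Prop) ->
  exists2 e, I e & forall a, I a -> J (a - a * e).

(** A module killed by J is semisimple, so K has a complement modulo W inside S.
    A submodule U that is maximal with K /\ U inside W works: for x in S the
    left ideal of the a with a x in U + K has an idempotent e, and U can be
    enlarged by (1 - e) x without gaining new elements of K outside W. *)
Lemma complement_mod (V : lmodType R) (S K W : V -> Prop) :
  idempotent_mod -> submodule K -> submodule W ->
  (forall a x, J a -> S x -> W (a *: x)) ->
  exists U : V -> Prop,
    [/\ submodule U, forall x, W x -> U x, forall x, U x -> K x -> W x
      & forall x, S x -> exists2 k, K k & U (x - k)].
Proof.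
move=> J_idem K_sub W_sub JS.
have [|U [U_sub WU UK U_max]] := @maximal_submodule_avoiding _ _ W
  (fun x => K x /\ ~ W x) W_sub; first by move=> x Wx [].
exists U; split=> // [x Ux Kx|x Sx].
  by apply: contrapT => nWx; apply: (UK x Ux).
pose I a := exists2 k, K k & U (a *: x - k).
have [|e [k Kk Ue] eI] := J_idem I.
  split; first by exists 0; [exact: submodule0 K_sub|rewrite scale0r subr0; exact: submodule0 U_sub].
  move=> a b c [k Kk Ub] [l Kl Uc]; exists (a *: k + l); first exact: K_sub.2.
  have := U_sub.2 a _ _ Ub Uc.
  suff -> : a *: ((b : R) *: x - k) + ((c : R) *: x - l) =
    (a * (b : R) + (c : R)) *: x - (a *: k + l) by [].
  by rewrite scalerDl scalerBr scalerA opprD addrACA.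
exists k => //.
(* By maximality of U, as U + R (1 - e) x meets K inside W. *)
suff Ux : U (x - e *: x).
  by rewrite -[x](subrK (e *: x)) -addrA; apply: submoduleD U_sub _ _.
apply: (U_max (fun y => exists u a, U u /\ y = u + a *: (x - e *: x))).
- split; first by exists 0, 0; rewrite scale0r addr0; split=> //; exact: submodule0 U_sub.
  move=> c _ _ [u [a [Uu ->]]] [v [b [Uv ->]]].
  exists (c *: u + v), (c * a + b); split; first exact: U_sub.2.
  by rewrite scalerDr scalerA scalerDl addrACA.
- by move=> u Uu; exists u, 0; rewrite scale0r addr0.
- move=> y [u [a [Uu yE]]] [Ky nWy]; apply: (UK y) => //.
  rewrite yE; apply: submoduleD => //; apply: WU.
  rewrite scalerBr scalerA -scalerBl; apply: JS => //; apply: eI.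
  exists (y + a *: k); first by rewrite addrC; apply: K_sub.2.
  rewrite (_ : _ - _ = a *: (e *: x - k) - u).
    by apply: submoduleB => //; apply: submoduleZ.
  rewrite yE !scalerBr [u + _]addrC !opprD !opprK !addrA subrr add0r.
  by rewrite addrAC.
by exists 0, 1; rewrite add0r scale1r; split=> //; apply: submodule0 U_sub.
Qed.

(** The Hopkins-Levitzki theorem.  Let U be minimal among the submodules between
    J K and K that together with finitely many elements generate K.  If U had an
    element x outside J K, a complement of R x modulo J K in U would be a smaller
    such submodule.  So K is finitely generated modulo J K, and nilpotence of J
    removes the remainder. *)
Lemma finitely_generated_submodule (V : lmodType R) (K : V -> Prop) n :
  idempotent_mod -> (forall a, Jpow n a -> a = 0) -> dcc V -> submodule K ->
  exists2 g : seq V, forall v, v \in g -> K v & forall x, K x -> generated g x.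
Proof.
move=> J_idem J_nil V_dcc K_sub.
pose JK := ideal_mul K.
have JK_sub : submodule JK := ideal_mul_submodule K.
have JKK x : JK x -> K x.
  by apply: ideal_mul_sub => // a y _ Ky; apply: submoduleZ.
pose F (U : V -> Prop) := [/\ submodule U, forall x, JK x -> U x, forall x, U x -> K x
  & exists2 g : seq V, forall v, v \in g -> K v
     & forall x, K x -> exists2 y, generated g y & U (x - y)].
have [||U [U_sub JKU UK [g gK gU]] U_min] := @dcc_minimal _ _ F K V_dcc.
- by move=> S [].
- by split=> //; exists [::] => // x Kx; exists 0; rewrite ?subr0.
have UJK x : U x -> JK x.
  move=> Ux; pose L y := exists a : R, y = a *: x.
  have L_sub : submodule L.
    split=> [|a _ _ [b ->] [c ->]]; first by exists 0; rewrite scale0r.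
    by exists (a * b + c); rewrite scalerDl scalerA.
  have [|U' [U'_sub JKU' U'L U_split]] := @complement_mod V U L JK J_idem L_sub JK_sub.
    by move=> a y Ja Uy; apply: ideal_mul_gen => //; apply: UK.
  suff U'x : U' x by apply: U'L => //; exists 1; rewrite scale1r.
  apply: (proj1 (U_min (fun y => U' y /\ U y) _ _ x Ux)); last by move=> y [].
  split=> [|y JKy|y [_ /UK] //|].
  - split; first by split; [exact: submodule0 U'_sub|exact: submodule0 U_sub].
    by move=> a y z [U'y Uy] [U'z Uz]; split; [apply: U'_sub.2|apply: U_sub.2].
  - by split; [apply: JKU'|apply: JKU].
  exists (x :: g) => [v|y Ky].
    by rewrite inE => /predU1P[->|]; [apply: UK|apply: gK].
  have [z gz Uyz] := gU y Ky.
  have [_ [a ->] U'yz] := U_split _ Uyz.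
  exists (a *: x + z); first by exists a, z.
  rewrite opprD addrCA addrC; split=> //.
  by apply: submoduleB => //; apply: submoduleZ.
exists g => // x Kx.
have gJ m y : iter m (@ideal_mul V) K y ->
    exists2 z, generated g z & iter m.+1 (@ideal_mul V) K (y - z).
  elim: m y => [|m IH] y /=; first by move=> /gU[z gz /UJK]; exists z.
  elim=> [|a u w Ja /IH[z gz Jz] _ [t gt Jt]].
    exists 0; first exact: submodule0 (generated_submodule g).
    by rewrite subr0; apply: ideal_mul0.
  exists (a *: z + t); first exact: (generated_submodule g).2.
  by rewrite opprD addrACA -scalerBr; apply: ideal_mulD.
have [m] : exists2 z, generated g z & iter n (@ideal_mul V) K (x - z).
  elim: (n) => [|m [z gz Jz]].
    exists 0; first exact: submodule0 (generated_submodule g).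
    by rewrite subr0.
  have [t gt Jt] := gJ _ _ Jz.
  exists (z + t); last by rewrite opprD addrA.
  exact: submoduleD (generated_submodule g) _ _.
by move=> gm /(iter_ideal_mul_pow0 J_nil)/subr0_eq ->.
Qed.
End RadicalPowers.

Section Artinian.
Variable R : pzRingType.
Hypothesis R_dcc : dcc R^o.
Local Notation J := (@jacobson_radical R).

(** Let L be a minimal left ideal with L + I = R.  If an element of L /\ I were
    outside a maximal left ideal M, then M /\ L would still satisfy
    (M /\ L) + I = R, against minimality; so L /\ I lies in J.  Writing
    1 = l + e gives a - a e = a l in L /\ I for every a in I. *)
Lemma jacobson_idempotent_mod : idempotent_mod J.
Proof.
move=> I I_sub.
pose F (L : R^o -> Prop) := submodule L /\ exists l e : R, [/\ L l, I e & 1 = l + e].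
have [||L [L_sub [l [e [Ll Ie E]]]] L_min] := @dcc_minimal _ _ F (fun _ => True) R_dcc.
- by move=> S [].
- split; first by [].
  by exists 1, 0; rewrite addr0; split=> //; apply: submodule0 I_sub.
suff LI x : L x -> I x -> J x.
  exists e => // a Ia.
  have aE : a - a * e = a * l by rewrite -{1}[a]mulr1 E mulrDr addrK.
  apply: LI; last exact: (submoduleB I_sub Ia (submoduleZ a I_sub Ie)).
  by rewrite aE; apply: (submoduleZ a L_sub Ll).
move=> Lx Ix M M_max; apply: contrapT => /negP xM.
have [/left_idealE M_sub _ _] := M_max.
case/negP: (xM).
apply: (proj2 (L_min (fun y => L y /\ y \in M) _ _ x Lx)); last by move=> y [].
split.
  split; first by split; [exact: submodule0 L_sub|exact: submodule0 M_sub].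
  by move=> a y w [Ly My] [Lw Mw]; split; [apply: L_sub.2|apply: M_sub.2].
have [m [a [mM lE]]] := maximal_left_ideal_add M_max xM l.
exists m, (a * x + e); split; last by rewrite addrA -lE.
  split=> //; rewrite -[m](addrK (a * x)) -lE.
  exact: (submoduleB L_sub Ll (submoduleZ a L_sub Lx)).
exact: (submoduleD I_sub (submoduleZ a I_sub Ix) Ie).
Qed.

(** The powers of J stop at some Q with Q Q = Q.  If Q were nonzero, let L be a
    minimal left ideal with Q L nonzero and l in L with Q l nonzero.  Then
    Q l = L by minimality, so l = c l with c in J, and invertibility of 1 - c
    forces l = 0. *)
Lemma jacobson_nilpotent :
  exists n, forall a, iter n (@ideal_mul R J R^o) (fun _ => True) a -> a = 0.
Proof.
have J_sub := jacobson_submodule R.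
pose P n := iter n (@ideal_mul R J R^o) (fun _ => True).
have P_sub n : submodule (P n) by apply: iter_ideal_mul_submodule.
have P_dec n x : P n.+1 x -> P n x.
  elim: n x => [|n IH] x //=; elim=> [|a y z Ja Py _ Pz]; first exact: ideal_mul0.
  by apply: ideal_mulD => //; apply: IH.
have [//|N NP] := R_dcc P_sub _ P_dec.
(* The successor guarantees that Q is contained in J. *)
exists N.+1 => a Pa; apply: contrapT => a_neq0.
pose Q := P N.+1.
have QN n x : Q x -> P n x.
  move=> Qx; have [Nn|/ltnW nN] := leqP N n; last exact: (decreasing_le P_dec nN (P_dec _ _ Qx)).
  by apply: NP => //; apply: P_dec.
pose F (L : R^o -> Prop) := submodule L /\ exists b l : R, [/\ Q b, L l & b * l <> 0].
have [||L [L_sub [b [l [Qb Ll bl]]]] L_min] := @dcc_minimal _ _ F (fun _ => True) R_dcc.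
- by move=> S [].
- by split=> //; exists a, 1; rewrite mulr1.
pose L' (y : R^o) := exists2 c, Q c & y = c * l.
have L'_sub : submodule L'.
  split; first by exists 0; rewrite ?mul0r //; apply: submodule0 (P_sub N.+1).
  move=> d _ _ [c Qc ->] [c' Qc' ->]; exists (d * c + c'); first exact: (P_sub N.+1).2.
  by rewrite mulrDl -mulrA.
have [||c Qc lE] := L_min L' _ _ l Ll.
- split=> //; apply: contrapT => no; apply: bl.
  have r_lin : linear (fun y : R^o => (y * l : R^o)).
    by move=> d y z; rewrite mulrDl -mulrA.
  rewrite -[LHS](@scale1r _ R^o) -(to_linearE r_lin b).
  apply: (iter_ideal_mul_kill (f := to_linear r_lin) (n := N.+1) (S := Q) (c := 1) _ (x := b)).
    move=> d y Qd Qy; rewrite scale1r; apply: contrapT => dy.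
    by apply: no; exists d, (y * l); split; [exact: Qd|exists y|exact: dy].
  by have := QN (N.+1 + N.+1)%N b Qb; rewrite /P iterD.
- by move=> y [c Qc ->]; apply: (submoduleZ c L_sub).
have Jc : J c.
  by apply: (ideal_mul_sub J_sub _ Qc) => d y Jd _; apply: jacobsonMr.
have [d [dE _]] := jacobson_inv 1 1 Jc.
apply: bl; suff -> : l = 0 by rewrite mulr0.
rewrite -[l]mul1r -dE -mulrA mulrBl mul1r mulr1 mul1r -lE subrr mulr0 //.
Qed.

Lemma stable_power (x : R) : exists n c, x ^+ n = c * x ^+ n.+1.
Proof.
pose S n (y : R^o) := exists c, y = c * x ^+ n.
have [|//||N NP] := R_dcc (S := S).
- move=> n; split=> [|a _ _ [c ->] [d ->]]; first by exists 0; rewrite mul0r.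
  by exists (a * c + d); rewrite mulrDl -mulrA.
- by move=> n _ [c ->]; exists (c * x); rewrite -mulrA -exprS.
have [|c E] := NP N.+1 (x ^+ N) (leqnSn N); first by exists 1; rewrite mul1r.
by exists N, c.
Qed.
End Artinian.

(** The idempotents of the opposite ring serve the same J because the radical
    does not depend on the side. *)
Lemma jacobson_idempotent_mod_right (A : pzRingType) : dcc (A^c)^o ->
  idempotent_mod (R := A^c) (@jacobson_radical A : A^c -> Prop).
Proof.
move=> Ac_dcc I /(jacobson_idempotent_mod Ac_dcc)[e Ie eI]; exists e => // a Ia.
exact: jacobson_converse (eI a Ia).
Qed.

(** * Base change along the homomorphism, and descent *)

Section FreeRadical.
Variable R : pzRingType.
Local Notation J := (@jacobson_radical R).

Lemma free_map_ideal_mul (X : eqType) (V : lmodType R) (f : {linear fsfun X R^o -> V})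
    (u : fsfun X R^o) :
  (forall x, J (u x)) -> ideal_mul J (fun y => exists x, f x = y) (f u).
Proof.
move=> uJ; have [s s_uniq su] := fsfun_support u.
rewrite {1}(fsfun_expand s_uniq su) linear_sum.
apply: submodule_sum => [|x]; first exact: (ideal_mul_submodule (jacobson_submodule R)).
by rewrite fsdelta_scale linearZ; apply: ideal_mul_gen; [|exists (fsdelta x 1)].
Qed.

Lemma free_radical_submodule (X : eqType) :
  submodule (fun u : fsfun X R^o => forall x, J (u x)).
Proof.
have J_sub := jacobson_submodule R.
split=> [x|a u w uJ wJ x]; first exact: jacobson0.
exact: (J_sub.2 a _ _ (uJ x) (wJ x)).
Qed.

Lemma free_map_radical (X Y : eqType) (f : {linear fsfun X R^o -> fsfun Y R^o})
    (u : fsfun X R^o) :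
  (forall x, J (u x)) -> forall y, J (f u y).
Proof.
move=> /(free_map_ideal_mul f).
apply: (ideal_mul_sub (T := fun u : fsfun Y R^o => forall x, J (u x))).
  exact: free_radical_submodule.
by move=> a w Ja _ y; rewrite fsfunZE; apply: jacobsonMr.
Qed.
End FreeRadical.

Section BaseChange.
Variables (A B : pzRingType) (phi : {rmorphism A -> B}).
Implicit Types X Y Z : eqType.

Definition fsphi X (g : fsfun X A^o) : fsfun X B^o :=
  fsmap (r := (phi : A^o -> B^o)) (rmorph0 phi) g.
Lemma fsphiE X (g : fsfun X A^o) x : fsphi g x = phi (g x). Proof. by []. Qed.
Lemma fsphi0 X : fsphi (0 : fsfun X A^o) = 0. Proof. exact: fsmap0. Qed.
Lemma fsphiD X : {morph @fsphi X : u w / u + w}.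
Proof. by apply: fsmapD => a b; apply: rmorphD. Qed.
Lemma fsphiZ X a (g : fsfun X A^o) : fsphi (a *: g) = phi a *: fsphi g.
Proof. by apply/fsfunP => x; rewrite fsfunZE !fsphiE; apply: rmorphM. Qed.
Lemma fsphi_delta X x a : fsphi (fsdelta x a : fsfun X A^o) = fsdelta x (phi a : B^o).
Proof. exact: fsmap_delta. Qed.

Definition base_change X Y (f : {linear fsfun X A^o -> fsfun Y A^o}) :
    {linear fsfun X B^o -> fsfun Y B^o} :=
  sval (cid (fsfun_lextend (fun x => fsphi (f (fsdelta x 1))))).

Lemma base_change_delta X Y (f : {linear fsfun X A^o -> fsfun Y A^o}) x (b : B) :
  base_change f (fsdelta x (b : B^o)) = b *: fsphi (f (fsdelta x 1)).
Proof. exact: (svalP (cid (fsfun_lextend (fun x => fsphi (f (fsdelta x 1)))))). Qed.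

Lemma base_change_fsphi X Y (f : {linear fsfun X A^o -> fsfun Y A^o}) g :
  base_change f (fsphi g) = fsphi (f g).
Proof.
elim/fsfun_ind: g => [|u w IHu IHw|x a].
- by rewrite !(linear0, fsphi0).
- by rewrite linearD !fsphiD linearD IHu IHw.
rewrite fsphi_delta base_change_delta -fsphiZ -linearZ fsdeltaZ.
by congr (fsphi (f (fsdelta _ _))); apply: mulr1.
Qed.

Lemma base_change_comp X Y Z (f : {linear fsfun Y A^o -> fsfun Z A^o})
    (g : {linear fsfun X A^o -> fsfun Y A^o}) (h : {linear fsfun X A^o -> fsfun Z A^o}) :
  (forall x, f (g x) = h x) -> forall u, base_change f (base_change g u) = base_change h u.
Proof.
move=> E; apply: (free_ext (f := base_change f \o base_change g)) => x /=.
by rewrite !base_change_delta !scale1r base_change_fsphi E.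
Qed.

Lemma base_change_zero X Y Z (f : {linear fsfun Y A^o -> fsfun Z A^o})
    (g : {linear fsfun X A^o -> fsfun Y A^o}) :
  (forall x, f (g x) = 0) -> forall u, base_change f (base_change g u) = 0.
Proof.
move=> E u; rewrite (base_change_comp (h := \0)) //.
apply: (free_ext (f := base_change \0) (g := \0)) => x /=.
by rewrite base_change_delta fsphi0 scaler0.
Qed.

Lemma base_change_regular X Y (f : {linear fsfun X A^o -> fsfun Y A^o}) :
  regular_map f -> regular_map (base_change f).
Proof.
case=> s fs; exists (base_change s) => u.
by rewrite (base_change_comp (h := f \o s)) // (base_change_comp (h := f)).
Qed.

Definition to_restr X (u : fsfun X B^o) : fsfun X (restr_right phi) :=
  fsmap (r := (fun b : B^o => b : restr_right phi)) erefl u.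
Definition of_restr X (u : fsfun X (restr_right phi)) : fsfun X B^o :=
  fsmap (r := (fun b : restr_right phi => b : B^o)) erefl u.
Lemma to_restrE X (u : fsfun X B^o) x : to_restr u x = u x. Proof. by []. Qed.

Lemma tensor_map_base_change X Y (f : {linear fsfun X A^o -> fsfun Y A^o}) u :
  tensor_map f (to_restr u) = to_restr (base_change f u).
Proof.
have rD Z : {morph @to_restr Z : v w / v + w} by apply: fsmapD.
elim/fsfun_ind: u => [|v w IHv IHw|x b].
- rewrite linear0; have -> Z : to_restr (0 : fsfun Z B^o) = 0 by apply: fsmap0.
  by rewrite tensor_map0; apply/fsfunP.
- by rewrite linearD !rD tensor_mapD IHv IHw.
rewrite base_change_delta /to_restr fsmap_delta tensor_map_delta.
by apply/fsfunP => y; rewrite tensE fsmapE fsfunZE.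
Qed.

(** The underlying groups of the complexes B (x)_A F, read with B as a right
    A-module or as a left B-module, coincide. *)
Lemma base_change_exact X Y Z (f : {linear fsfun X A^o -> fsfun Y A^o})
    (g : {linear fsfun Y A^o -> fsfun Z A^o}) :
  tensor_exact (restr_right phi) f g ->
  forall u, base_change g u = 0 -> exists w, base_change f w = u.
Proof.
move=> ex u gu0; have [|w wE] := ex (to_restr u).
  by rewrite tensor_map_base_change gu0; apply: fsmap0.
exists (of_restr w); apply/fsfunP => y.
rewrite -[RHS](to_restrE u) -wE -[LHS]to_restrE -tensor_map_base_change.
suff -> : to_restr (of_restr w) = w by [].
by apply/fsfunP.
Qed.

Section Descent.
Hypothesis A_dcc : dcc A^o.
Hypothesis Ac_dcc : dcc (A^c)^o.
Hypothesis phi_rad : radical_preserving phi.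
Hypothesis phi_ker : superfluous_kernel phi.

(** Injectivity of A/J(A) -> B/J(B).  Put y = 1 - a x; its image is a unit, and
    y^n = c y^(n+1) for some n and c.  So (1 - c y) y^n = 0, the image of 1 - c y
    is 0, and 1 - c y lies in J(A) because the kernel does; hence c y is
    invertible. *)
Lemma jacobson_reflect x : jacobson_radical (phi x) -> jacobson_radical x.
Proof.
move=> xJ; apply/jacobson_left_inv => a.
have [n [c cE]] := stable_power A_dcc (1 - a * x).
have axJ : jacobson_radical (phi (a * x)) by rewrite rmorphM; apply: jacobsonMl.
have [d [_ dE]] := jacobson_inv 1 1 axJ.
rewrite mul1r mulr1 in dE.
have phi_unit : phi (1 - a * x) * d = 1 by rewrite rmorphB rmorph1.
have kerJ : jacobson_radical (1 - c * (1 - a * x)).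
  apply: phi_ker; have : phi ((1 - c * (1 - a * x)) * (1 - a * x) ^+ n) = 0.
    by rewrite mulrBl mul1r -mulrA -exprS -cE subrr rmorph0.
  elim: n {cE} => [|n IH]; first by rewrite mulr1.
  rewrite exprSr mulrA rmorphM => E; apply: IH.
  by rewrite -[LHS]mulr1 -phi_unit mulrA E mul0r.
have [e [eE _]] := jacobson_inv 1 1 kerJ.
by exists (e * c); rewrite -mulrA -[RHS]eE mul1r mulr1 subKr.
Qed.

(** The map A/J(A) -> B/J(B) of right A-modules splits, as its target is killed
    by J(A).  The submodule U is the kernel of a retraction onto A/J(A), taken in
    B. *)
Lemma right_complement : exists U : restr_right phi -> Prop,
  [/\ submodule U, forall b : B, jacobson_radical b -> U b,
      forall a : A, U (phi a) -> jacobson_radical a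
    & forall b : B, exists a : A, U (b - phi a)].
Proof.
have [|||U [U_sub WU UK U_split]] := @complement_mod A^c _ (restr_right phi)
  (fun _ => True) (fun b => exists a, phi a = b) (@jacobson_radical B)
  (jacobson_idempotent_mod_right Ac_dcc).
- split; first by exists 0; rewrite rmorph0.
  by move=> a _ _ [b <-] [c <-]; exists (b * a + c); rewrite rmorphD rmorphM.
- split; first exact: jacobson0.
  by move=> a x y xJ yJ; apply: jacobsonD => //; apply: jacobsonMr.
- by move=> a x aJ _; apply: jacobsonMl; apply: phi_rad.
exists U; split=> // [a Ua|b].
  by apply: jacobson_reflect; apply: UK => //; exists a.
by have [//|_ [a <-] Uba] := U_split b; exists a.
Qed.

(** The retraction of B onto A modulo U commutes with the differentials. *)
Lemma lift_mod_complement (U : restr_right phi -> Prop) X Y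
    (f : {linear fsfun X A^o -> fsfun Y A^o}) (z : fsfun X B^o) :
  submodule U -> (forall b : B, exists a : A, U (b - phi a)) ->
  exists g : fsfun X A^o, forall y, U (base_change f z y - phi (f g y)).
Proof.
move=> U_sub U_split; elim/fsfun_ind: z => [|z1 z2 [g1 E1] [g2 E2]|x b].
- exists 0 => y; rewrite !linear0 !fsfun0E rmorph0 subr0; exact: submodule0 U_sub.
- exists (g1 + g2) => y; rewrite !linearD !fsfunDE rmorphD opprD addrACA.
  exact: (submoduleD U_sub (E1 y) (E2 y)).
have [a Ua] := U_split b; exists (fsdelta x a) => y.
rewrite base_change_delta [fsdelta x a]fsdelta_scale linearZ !fsfunZE fsphiE.
have := submoduleZ (f (fsdelta x 1) y : A^c) U_sub Ua.
suff -> : (f (fsdelta x 1) y : A^c) *: (b - phi a : restr_right phi) =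
  b * phi (f (fsdelta x 1) y) - phi (a * (f (fsdelta x 1) y : A)) by [].
by rewrite rmorphM -mulrBl.
Qed.

Section Maps.
Variables (X2 X1 X0 : eqType) (d1 : {linear fsfun X2 A^o -> fsfun X1 A^o})
  (d0 : {linear fsfun X1 A^o -> fsfun X0 A^o}).
Hypothesis d01 : forall x, d0 (d1 x) = 0.
Hypothesis dB_exact : forall u, base_change d0 u = 0 -> exists w, base_change d1 w = u.
Hypothesis dB_regular : regular_map (base_change d0).
Local Notation J := (@jacobson_radical A).
Local Notation K := (fun v => exists y, d0 y = v).

(** This is im d0 /\ J F = J (im d0), the vanishing of Tor_1^A(A/J, coker d0).
    Over B, if v = s (d0 y) then y - v is a cycle, hence a boundary, while v has
    coordinates in J(B).  Retracting to A modulo U, y is a boundary d1 g up to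
    coordinates in J(A), and d0 y = d0 (y - d1 g). *)
Lemma image_radical y : (forall x, J (d0 y x)) -> ideal_mul J K (d0 y).
Proof.
move=> yJ; have [s sE] := dB_regular.
pose v := s (base_change d0 (fsphi y)).
have vJ x : jacobson_radical (v x).
  apply: (free_map_radical s) => {}x; rewrite base_change_fsphi; exact: phi_rad.
have [|z zE] := dB_exact (u := fsphi y - v); first by rewrite linearB sE subrr.
have [U [U_sub JU UJ U_split]] := right_complement.
have [g gE] := lift_mod_complement d1 z U_sub U_split.
rewrite -[d0 y](subr0) -(d01 g) -linearB; apply: free_map_ideal_mul => x.
apply: UJ; rewrite fsfunDE fsfunNE rmorphB.
have := submoduleD U_sub (gE x) (JU _ (vJ x)).
by rewrite zE fsfunDE fsfunNE fsphiE addrAC subrK.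
Qed.

(** On K = im d0 the endomorphism n = 1 - d0 s takes values in J K, so n^t = 0
    there.  On all of F the map 1 - n^t factors through d0, because 1 - n does;
    hence it is a retraction of F onto K of the form d0 r. *)
Lemma regular_descent : regular_map d0.
Proof.
have J_sub := jacobson_submodule A.
have K_sub : submodule K := submodule_im d0.
have JF_sub := @free_radical_submodule A X0.
have [|U [U_sub _ UK U_split]] := complement_mod (S := fun _ => True)
  (jacobson_idempotent_mod A_dcc) K_sub JF_sub.
  by move=> a v aJ _ x; rewrite fsfunZE; apply: jacobsonMr.
have /choice[l lE] : forall x, exists y, U (fsdelta x 1 - d0 y).
  by move=> x; have [//|_ [y <-] Uy] := U_split (fsdelta x 1); exists y.
(* Modulo J F, the map d0 s is the projection onto K along the complement U. *)
have [s sE] := fsfun_lextend l.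
pose n : {linear fsfun X0 A^o -> fsfun X0 A^o} := idfun \- (d0 \o s).
have nE v : n v = v - d0 (s v) by [].
have Un v : U (n v).
  elim/fsfun_ind: v => [|v w IHv IHw|x a].
  - by rewrite linear0; apply: submodule0 U_sub.
  - by rewrite linearD; apply: submoduleD.
  rewrite fsdelta_scale linearZ; apply: submoduleZ => //.
  by rewrite nE sE scale1r.
have nK v : K v -> ideal_mul J K (n v).
  move=> Kv; have [y yE] : K (n v) by apply: (submoduleB K_sub Kv); exists (s v).
  by rewrite -yE; apply: image_radical; rewrite yE; apply: UK => //; exists y.
have n_iter t v : iter t (@ideal_mul A J _) K v -> iter t.+1 (@ideal_mul A J _) K (n v).
  elim: t v => [|t IH] v; first exact: nK.
  apply: (ideal_mul_sub (T := fun v => iter t.+2 (@ideal_mul A J _) K (n v))).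
    have T_sub := iter_ideal_mul_submodule J_sub t.+2 K_sub.
    split; first by rewrite linear0; apply: submodule0 T_sub.
    by move=> a u w Tu Tw; rewrite linearP; apply: T_sub.2.
  by move=> a u aJ /IH Ju; rewrite linearZ; apply: ideal_mul_gen.
have [t t_nil] := jacobson_nilpotent A_dcc.
have n_nil v : K v -> iter t n v = 0.
  move=> Kv; apply: (iter_ideal_mul_pow0 (S := K) t_nil).
  by elim: (t) => [|j IH] //=; apply: n_iter.
have [r rE] : exists r : {linear fsfun X0 A^o -> fsfun X1 A^o},
    forall v, d0 (r v) = v - iter t n v.
  elim: (t) => [|j [r rE]]; first by exists \0 => v; rewrite linear0 subrr.
  exists ((r \o n) \+ s) => v; rewrite iterSr.
  transitivity (d0 (r (n v) + s v)); first by [].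
  by rewrite linearD rE addrAC {1}nE subrK.
by exists r => y; rewrite rE n_nil ?subr0 //; exists y.
Qed.
End Maps.
End Descent.
End BaseChange.

(** * Free resolutions and the comparison of dimensions *)

Definition finite_index (X : eqType) := exists s : seq X, forall x, x \in s.

Section FreeResolution.
Variable R : pzRingType.

Lemma finite_index_generated (X : eqType) :
  finite_index X -> finitely_generated (fsfun X R^o : lmodType R).
Proof.
case=> s sP; apply/finitely_generatedP.
exists [seq fsdelta x (1 : R^o) | x <- s] => u.
have g_sub := generated_submodule [seq fsdelta x (1 : R^o) | x <- s].
elim/fsfun_ind: u => [|u w gu gw|x a].
- exact: submodule0 g_sub.
- exact: submoduleD g_sub gu gw.
rewrite fsdelta_scale.
by apply: (submoduleZ _ g_sub); apply: generated_mem; apply: map_f.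
Qed.

Lemma finitely_generated_surj (V W : lmodType R) (f : {linear V -> W}) :
  (forall y, exists x, f x = y) -> finitely_generated V -> finitely_generated W.
Proof.
move=> f_surj [n [g gP]]; exists n, (fun i => f (g i)) => y.
have [x <-] := f_surj y; have [c ->] := gP x; exists c.
by rewrite linear_sum; apply: eq_bigr => i _; rewrite linearZ.
Qed.

Lemma free_map_of_seq (V : lmodType R) (g : seq V) :
  exists f : {linear fsfun 'I_(size g) R^o -> V},
    forall y, generated g y <-> exists x, f x = y.
Proof.
have [f fE] := fsfun_lextend (tnth (in_tuple g)); exists f => y; split.
  apply: (generated_sub (submodule_im f)) => v.
  rewrite -[g in v \in g]/(val (in_tuple g)) => /tnthP[i ->].
  by exists (fsdelta i 1); rewrite fE scale1r.
case=> x <-; have g_sub := generated_submodule g.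
elim/fsfun_ind: x => [|u w gu gw|i a].
- by rewrite linear0; apply: submodule0 g_sub.
- by rewrite linearD; apply: submoduleD g_sub gu gw.
rewrite fE; apply: (submoduleZ _ g_sub); apply: generated_mem.
exact: (mem_tnth i (in_tuple g)).
Qed.

Hypothesis noetherian : forall (X : eqType) (K : fsfun X R^o -> Prop),
  finite_index X -> submodule K -> exists g, forall x, K x <-> generated g x.

(** A single statement for both cases lets the resolution be chosen once, with
    finite ranks whenever they are possible. *)
Lemma finite_free_cover (M : lmodType R) :
  exists (X : eqType) (p : {linear fsfun X R^o -> M}),
    (forall y, exists x, p x = y) /\ (finitely_generated M -> finite_index X).
Proof.
have [M_fg|M_nfg] := pselect (finitely_generated M); last first.
  by have [p p_surj] := free_cover M; exists M, p; split.
have [g gP] := (finitely_generatedP M).1 M_fg.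
have [p pP] := free_map_of_seq g; exists 'I_(size g), p; split=> [y|_].
  exact: (pP y).1 (gP y).
by exists (enum 'I_(size g)) => i; rewrite mem_enum.
Qed.

Lemma finite_free_kernel (X : eqType) (W : lmodType R) (p : {linear fsfun X R^o -> W}) :
  exists (Y : eqType) (d : {linear fsfun Y R^o -> fsfun X R^o}),
    (forall x, p x = 0 <-> exists y, d y = x) /\ (finite_index X -> finite_index Y).
Proof.
have [X_fin|X_inf] := pselect (finite_index X); last first.
  by have [Y [d dP]] := free_cover_kernel p; exists Y, d; split.
have [|g gP] := @noetherian X (fun x => p x = 0) X_fin.
  split; first exact: linear0.
  by move=> a x y px py; rewrite linearP px py scaler0 addr0.
have [d dP] := free_map_of_seq g; exists 'I_(size g), d; split=> [x|_].
  by rewrite gP.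
by exists (enum 'I_(size g)) => i; rewrite mem_enum.
Qed.

(** Bundled so that, in an iteration, the target of each differential is by
    computation the source of the preceding one. *)
Record free_map := FreeMap {
  free_source : eqType;
  free_target : eqType;
  free_arrow : {linear fsfun free_source R^o -> fsfun free_target R^o} }.

Lemma free_resolution (M : lmodType R) :
  exists (X : nat -> eqType) (d : forall i, {linear fsfun (X i.+1) R^o -> fsfun (X i) R^o})
    (e : {linear fsfun (X 0%N) R^o -> M}),
  [/\ forall i x, d i x = 0 <-> exists y, d i.+1 y = x,
      forall y, exists x, e x = y, forall x, e x = 0 <-> exists y, d 0%N y = x
    & finitely_generated M -> forall i, finite_index (X i)].
Proof.
have [X0 [e [e_surj X0_fin]]] := finite_free_cover M.
have [X1 [d0 [ker_e X1_fin]]] := finite_free_kernel e.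
have step (f : free_map) :
    exists Yd : {Y : eqType & {linear fsfun Y R^o -> fsfun (free_source f) R^o}},
    (forall x, free_arrow f x = 0 <-> exists y, projT2 Yd y = x) /\
    (finite_index (free_source f) -> finite_index (projT1 Yd)).
  have [Y [d dP]] := finite_free_kernel (free_arrow f).
  by exists (existT _ Y d).
pose next f := sval (cid (step f)).
have nextP f := svalP (cid (step f)).
pose S i := iter i (fun f => FreeMap (projT2 (next f))) (FreeMap d0).
exists (fun i => free_target (S i)), (fun i => free_arrow (S i)), e.
split=> // [i x|M_fg]; first exact: (nextP (S i)).1.
have fin i : finite_index (free_target (S i)) /\ finite_index (free_source (S i)).
  elim: i => [|i [_ IH]]; first by split; [apply: X0_fin|apply/X1_fin/X0_fin].
  by split; [exact: IH|apply: (nextP (S i)).2].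
by move=> i; have [] := fin i.
Qed.
End FreeResolution.

Section ArtinAlgebra.
Variables (k : comPzRingType) (A : algType k).
Hypothesis hA : artin_algebra A.

(** Left and right ideals of A are k-submodules, so the descending chain
    condition over k bounds both. *)
Lemma artin_algebra_dcc : dcc (A : lmodType k).
Proof.
have [k_art A_fg] := hA; apply: dcc_finitely_generated => // I I_sub _ I_dec.
pose I' n : {pred k} := fun x => `[< I n x >].
have I'P n x : reflect (I n x) (x \in I' n) by exact: asboolP.
have [||N NP] := k_art I'.
- move=> n; apply/left_idealE; split; first by apply/I'P; apply: submodule0 (I_sub n).
  by move=> a x y /I'P Ix /I'P Iy; apply/I'P; apply: (I_sub n).2.
- by move=> n x /I'P Ix; apply/I'P/I_dec.
by exists N => n x /NP E /I'P; rewrite -E => /I'P.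
Qed.

Lemma artin_algebra_dcc_left : dcc A^o.
Proof.
move=> S S_sub _ S_dec; apply: artin_algebra_dcc => // n.
split; first exact: submodule0 (S_sub n).
move=> a x y Sx Sy; rewrite -[x]mul1r scalerAl.
exact: (S_sub n).2.
Qed.

Lemma artin_algebra_dcc_right : dcc (A^c)^o.
Proof.
move=> S S_sub _ S_dec; apply: artin_algebra_dcc => // n.
split; first exact: submodule0 (S_sub n).
move=> a x y Sx Sy; rewrite -[x]mulr1 scalerAr.
exact: ((S_sub n).2 (a *: (1 : A))).
Qed.
End ArtinAlgebra.

Section Comparison.
Variables (A B : pzRingType) (phi : {rmorphism A -> B}).
Hypothesis A_dcc : dcc A^o.
Hypothesis Ac_dcc : dcc (A^c)^o.
Hypothesis phi_rad : radical_preserving phi.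
Hypothesis phi_ker : superfluous_kernel phi.

Lemma artinian_noetherian (X : eqType) (K : fsfun X A^o -> Prop) :
  finite_index X -> submodule K -> exists g, forall x, K x <-> generated g x.
Proof.
move=> X_fin K_sub; have [n J_nil] := jacobson_nilpotent A_dcc.
have F_dcc : dcc (fsfun X A^o : lmodType A).
  by apply: dcc_finitely_generated A_dcc _; apply: finite_index_generated.
have [g gK Kg] := finitely_generated_submodule (jacobson_submodule A)
  (jacobson_idempotent_mod A_dcc) J_nil F_dcc K_sub.
by exists g => x; split; [apply: Kg|apply: generated_sub].
Qed.

(** N is the m-th syzygy of M base-changed to B.  Its free resolution is the
    base change of that of M from degree m on, exact there because Tor_i^A(B, M)
    vanishes for i > m; regularity of the differentials then passes both ways. *)
Lemma pd_comparison m (M : lmodType A) : pd_right phi = Fin m ->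
  exists N : lmodType B,
    [/\ finitely_generated M -> finitely_generated N,
        pd M <> Infty -> pd N <> Infty
      & enat_le (pd M) (enat_add (pd N) (Fin m))].
Proof.
move=> /enat_leastP/projdim_le_of_resolution pd_B.
have [X [d [e [ker_d e_surj ker_e X_fin]]]] := free_resolution artinian_noetherian M.
have dB_exact i u : (m <= i)%N -> base_change phi (d i) u = 0 ->
    exists w, base_change phi (d i.+1) w = u.
  by move=> mi; apply: base_change_exact; apply: (projdim_tensor_exact ker_d pd_B).
(* With i on the left, (i.+1 + m) is (i + m).+1 by computation. *)
pose C i : lmodType B := fsfun (X (i + m)%N) B^o.
pose dC i : {linear C i.+1 -> C i} := base_change phi (d (i + m)%N).
have C_proj i : projective (C i) by exact: free_projective.
have ker_dC i x : dC i x = 0 <-> exists y, dC i.+1 y = x.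
  split=> [|[y <-]]; first by apply: dB_exact; apply: leq_addl.
  by apply: base_change_zero => z; apply/ker_d; exists z.
pose N := coker (dC 0%N); exists N.
have pdN n : projdim_le n N <-> regular_map (base_change phi (d (n + m)%N)).
  exact: (projdim_le_coker n C_proj ker_dC).
have pdM n : projdim_le n M <-> regular_map (d n).
  by apply: (projdim_le_resolution n _ ker_d e_surj ker_e) => i; apply: free_projective.
split=> [M_fg|/pd_finP[n [_ Mn]]|].
- by apply: finitely_generated_surj (@coker_surj _ _ _ _) (finite_index_generated _ (X_fin M_fg _)).
- suff /pd_leP : projdim_le n N by case: (pd N).
  apply/pdN/base_change_regular/pdM; apply: projdim_leW Mn; exact: leq_addr.
case E: (pd N) => [n|]; last by case: (pd M).
have /pd_finP[n' []] : pd N <> Infty by rewrite E.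
rewrite E => -[<-] /pdN Nn; apply: pd_leP; apply/pdM.
apply: (regular_descent A_dcc Ac_dcc phi_rad phi_ker (d1 := d (n + m).+1)) Nn.
  by move=> x; apply/ker_d; exists x.
by move=> u; apply: dB_exact; apply: leq_addl.
Qed.
End Comparison.

Lemma enat_le_trans y x z : enat_le x y -> enat_le y z -> enat_le x z.
Proof. by case: x y z => [a|] [b|] [c|] //=; apply: leq_trans. Qed.

Lemma enat_le_add2r z x y : enat_le x y -> enat_le (enat_add x z) (enat_add y z).
Proof. by case: x y z => [a|] [b|] [c|] //=; rewrite leq_add2r. Qed.

Theorem theoremA (k l : comPzRingType) (A : algType k) (B : algType l)
    (phi : {rmorphism A -> B})
    (hA : artin_algebra A) (hB : artin_algebra B)
    (hrad : radical_preserving phi) (hker : superfluous_kernel phi) :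
  [/\ enat_le (findim A) (enat_add (findim B) (pd_right phi)),
      enat_le (Findim A) (enat_add (Findim B) (pd_right phi))
    & enat_le (gldim A) (enat_add (gldim B) (pd_right phi))].
Proof.
case E: (pd_right phi) => [m|]; last first.
  have top x y : enat_le x (enat_add y Infty) by case: x y => [a|] [b|].
  by split; apply: top.
have cmp M := pd_comparison (artin_algebra_dcc_left hA) (artin_algebra_dcc_right hA)
  hrad hker M E.
split; apply: enat_sup_lub.
- move=> _ [M [M_fg M_fin ->]]; have [N [N_fg N_fin MN]] := cmp M.
  apply: (enat_le_trans MN); apply: enat_le_add2r; apply: enat_sup_ub.
  by exists N; split=> //; [apply: N_fg|apply: N_fin].
- move=> _ [M [M_fin ->]]; have [N [_ N_fin MN]] := cmp M.
  apply: (enat_le_trans MN); apply: enat_le_add2r; apply: enat_sup_ub.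
  by exists N; split=> //; apply: N_fin.
move=> _ [M ->]; have [N [_ _ MN]] := cmp M.
apply: (enat_le_trans MN); apply: enat_le_add2r; apply: enat_sup_ub.
by exists N.
Qed.
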